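(* Let $\Lambda$ be a finite, strongly connected $k$-graph, let $\delta\in(0,1)$, and suppose that $w_\delta$ is a weight satisfying $w_\delta(\lambda)=\operatorname{diam}[\lambda]$ for all $\lambda\in F\mathcal B_\Lambda$. Then $|D|^{-\delta}$ is Connes measurable, and its Dixmier trace is positive.
   Context: $\mathbb N=\{0,1,2,\dots\}$. A $k$-graph ($k\ge 1$) is a countable small category $\Lambda$ with a functor $d:\Lambda\to\mathbb N^k$ ($\mathbb N^k$ viewed as a one-object category under addition) such that whenever $d(\lambda)=m+n$ there are unique $\mu,\nu\in\Lambda$ with $d(\mu)=m$, $d(\nu)=n$, $\lambda=\mu\nu$. Here $\lambda\in\Lambda$ means $\lambda$ is a morphism; $\Lambda^n=d^{-1}(n)$; $\Lambda^0$ is identified with the objects (vertices); $r,s:\Lambda\to\Lambda^0$ are range and source. $\Lambda$ is finite if every $\Lambda^n$ is finite, and strongly connected if for all $v,w\in\Lambda^0$ there is $\lambda\in\Lambda$ with $r(\lambda)=v$, $s(\lambda)=w$. With $e_i$ the standard basis of $\mathbb N^k$, the adjacency matrices are $A_i(v,w)=\#\{\lambda\in\Lambda^{e_i}: r(\lambda)=v,\ s(\lambda)=w\}$; $\rho_i$ is the spectral radius of $A_i$. For $\Lambda$ finite and strongly connected, $x^\Lambda\in(0,\infty)^{\Lambda^0}$ is the unique positive vector with $\sum_v x^\Lambda_v=1$ and $A_ix^\Lambda=\rho_ix^\Lambda$ for $1\le i\le k$. The stationary $k$-Bratteli diagram $\mathcal B_\Lambda$ has vertex set $\bigsqcup_{n\ge0}\mathcal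 V_n$, each $\mathcal V_n$ a copy of $\Lambda^0$, and edge set $\bigsqcup_{n\ge1}\mathcal E_n$, where for $n\equiv i \pmod k$, $1\le i\le k$, $\mathcal E_n$ contains exactly $A_i(p,q)$ edges with range $p\in\mathcal V_{n-1}$ and source $q\in\mathcal V_n$. $F\mathcal B_\Lambda$ is the set of finite paths $\eta=\eta_1\cdots\eta_m$ ($\eta_i\in\mathcal E_i$, $s(\eta_i)=r(\eta_{i+1})$), of length $|\eta|=m$; vertices in $\mathcal V_0$ are the paths of length $0$. $X_{\mathcal B_\Lambda}$ is the set of infinite paths $(x_n)_{n\ge1}$, $x_n\in\mathcal E_n$, $s(x_n)=r(x_{n+1})$; $[\lambda]$ is the set of infinite paths with initial segment $\lambda\in F\mathcal B_\Lambda$. A weight is a function $w:F\mathcal B_\Lambda\to(0,\infty)$ with $\sum_{v\in\mathcal V_0}w(v)\le1$, $\lim_{n}\sup\{w(\lambda):|\lambda|=n\}=0$, and $w(\lambda)<w(\eta)$ whenever $\eta$ is a proper initial segment of $\lambda$. For $\delta\in(0,1)$ and $|\eta|=qk+t$ with $q\in\mathbb N$, $0\le t\le k-1$, $$w_\delta(\eta)=\big(\rho_1^{q+1}\cdots\rho_t^{q+1}\rho_{t+1}^q\cdots\rho_k^q\big)^{-1/\delta}x^\Lambda_{s(\eta)}.$$ For $x\ne y$ in $X_{\mathcal B_\Lambda}$, $x\wedge y$ is the longest common initial segment in $F\mathcal B_\Lambda$ ($\emptyset$ if $r(x)\neq r(y)$); $d_\delta(x,y)=w_\delta(x\wedge y)$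 if $x\wedge y\ne\emptyset$, $d_\delta(x,y)=1$ if $x\wedge y=\emptyset$, and $d_\delta(x,x)=0$; $\operatorname{diam}[\lambda]=\sup\{d_\delta(x,y):x,y\in[\lambda]\}$. On $\mathcal H=\ell^2(F\mathcal B_\Lambda,\mathbb C^2)$ let $D=\bigoplus_{\gamma\in F\mathcal B_\Lambda}\frac1{\operatorname{diam}[\gamma]}\begin{pmatrix}0&1\\1&0\end{pmatrix}$ (the Dirac operator of the Pearson–Bellissard spectral triple); $|D|^{-1}$ is multiplication by $\operatorname{diam}[\gamma]$ on the $\gamma$-summand. Let $\sigma_0(T)\ge\sigma_1(T)\ge\cdots$ be the singular values of a compact operator $T$ on a separable Hilbert space, with multiplicity. The Dixmier–Macaev ideal $\mathcal M_{1,\infty}$ consists of the compact $T$ with $\limsup_n\frac1{\ln n}\sum_{j=1}^n\sigma_j(T)<\infty$. For a (dilation-invariant) generalized limit $\omega$ on $\ell^\infty(\mathbb N)$ (a state vanishing on $c_0$), the Dixmier trace $\mathcal T_\omega$ is the linear functional on $\mathcal M_{1,\infty}$ given on positive $T$ by $\mathcal T_\omega(T)=\omega\big(\big(\frac1{\ln(2+n)}\sum_{j\le n}\sigma_j(T)\big)_n\big)$. $T\in\mathcal M_{1,\infty}$ is Connes measurable if $\mathcal T_\omega(T)$ is the same for all such $\omega$; the common value $\mathcal T(T)$ is its Dixmier trace. For positive $T$, Connes measurability is equivalent to existence and finiteness of $\lim_{s\searrow1}(s-1)\operatorname{Tr}(T^s)$, and then $\mathcal T(T)$ equals this limit. *)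

(* Defs.v *)
From mathcomp Require Import all_boot all_order all_algebra finmap.
From mathcomp Require Import spectral.
From mathcomp Require Import all_classical all_reals all_analysis.
From mathcomp Require Import complex.
Set Implicit Arguments.
Unset Strict Implicit.
Unset Printing Implicit Defensive.
Import Order.TTheory GRing.Theory Num.Theory.
Import numFieldNormedType.Exports.
Local Open Scope classical_set_scope.
Local Open Scope ring_scope.
Local Open Scope complex_scope.

(* A countable small category with object set [V] and morphism set [mor],
   graded by N^k.  [comp l m] is the composite "l m"; it is constrained only
   when [src l = rng m]. *)
Record kgraph (k : nat) (V : countType) := KGraph {
  mor :> countType;
  rng : mor -> V;
  src : mor -> V;
  idm : V -> mor;
  comp : mor -> mor -> mor;
  deg : mor -> {ffun 'I_k -> nat};
  rng_idm : forall v, rng (idm v) = v;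
  src_idm : forall v, src (idm v) = v;
  rng_comp : forall l m, src l = rng m -> rng (comp l m) = rng l;
  src_comp : forall l m, src l = rng m -> src (comp l m) = src m;
  comp_idl : forall l, comp (idm (rng l)) l = l;
  comp_idr : forall l, comp l (idm (src l)) = l;
  compA : forall l m n, src l = rng m -> src m = rng n ->
    comp l (comp m n) = comp (comp l m) n;
  deg_idm : forall v, deg (idm v) = 0;
  deg_comp : forall l m, src l = rng m -> deg (comp l m) = deg l + deg m;
  unique_factorization : forall (l : mor) (m n : {ffun 'I_k -> nat}),
    deg l = m + n ->
    exists! p : mor * mor,
      [/\ src p.1 = rng p.2, deg p.1 = m, deg p.2 = n & l = comp p.1 p.2]
}.

Definition kgraph_finite k (V : countType) (L : kgraph k V) : Prop :=
  forall n : {ffun 'I_k -> nat}, finite_set [set l : L | deg l = n].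

Definition strongly_connected k (V : countType) (L : kgraph k V) : Prop :=
  forall v w : V, exists l : L, rng l = v /\ src l = w.

(* The generators of N^k and everything derived from them are indexed from 0;
   only indices [i < k] are meaningful. *)
Definition stdgen (k i : nat) : {ffun 'I_k -> nat} :=
  [ffun j : 'I_k => (val j == i : nat)].

Definition adj k (V : countType) (L : kgraph k V) (i : nat) (v w : V) : nat :=
  #|` fset_set [set l : L | [/\ deg l = stdgen k i, rng l = v & src l = w]] |.

Definition spectral_radius (R : realType) n (A : 'M[R[i]]_n) : R :=
  sup [set Normc.normc z | z in [set z : R[i] | eigenvalue A z]].

Definition adjmx (R : realType) k (V : finType) (L : kgraph k V) (i : nat) :
    'M[R[i]]_#|V| :=
  \matrix_(p, q) (adj L i (enum_val p) (enum_val q))%:R.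

Definition rho (R : realType) k (V : finType) (L : kgraph k V) (i : nat) : R :=
  spectral_radius (adjmx R L i).

Definition is_pf_vector (R : realType) k (V : finType) (L : kgraph k V)
    (x : V -> R) : Prop :=
  [/\ forall v, 0 < x v,
      \sum_v x v = 1 &
      forall (i : 'I_k) v, \sum_w (adj L i v w)%:R * x w = rho R L i * x v].

(* Definite description of the vector x^L; the value 0 is returned if no such
   vector exists. *)
Definition pf_vector (R : realType) k (V : finType) (L : kgraph k V) : V -> R :=
  xget (fun=> 0) [set x | is_pf_vector L x].

(* An edge is [(p, q, j)], with range [p] and source [q]; it belongs to E_n iff
   [j < A_i(p, q)] where n = i (mod k).  With [i] counted from 0, the matrix
   used at level [n >= 1] has index [n.-1 %% k]. *)
Section Bratteli.
Variables (k : nat) (V : finType) (L : kgraph k V).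

Definition bedge : Type := (V * V * nat)%type.
Definition erng (e : bedge) : V := e.1.1.
Definition esrc (e : bedge) : V := e.1.2.
Definition in_level (n : nat) (e : bedge) : bool :=
  (e.2 < adj L (n.-1 %% k) (erng e) (esrc e))%N.

(* [chain n p s]: [s] is a path that starts at the vertex [p] of V_n and whose
   successive edges lie in E_(n+1), E_(n+2), ... *)
Fixpoint chain (n : nat) (p : V) (s : seq bedge) : bool :=
  if s is e :: s' then
    [&& erng e == p, in_level n.+1 e & chain n.+1 (esrc e) s']
  else true.

(* A finite path is stored with its range, so that the paths of length 0 are
   the vertices of V_0. *)
Definition finpath : Type := {g : V * seq bedge | chain 0 g.1 g.2}.
Definition frng (g : finpath) : V := (val g).1.
Definition fedges (g : finpath) : seq bedge := (val g).2.
Definition flen (g : finpath) : nat := size (fedges g).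
Definition fsrc (g : finpath) : V := last (frng g) (map esrc (fedges g)).
Definition fvertex (v : V) : finpath :=
  exist (fun g : V * seq bedge => chain 0 g.1 g.2) (v, [::]) isT.

Definition proper_initial (g l : finpath) : Prop :=
  [/\ frng g = frng l, prefix (fedges g) (fedges l) & (flen g < flen l)%N].

(* The edge x_(n+1) of an infinite path (x_n)_(n >= 1) is [x n]. *)
Definition infpath : set (nat -> bedge) :=
  [set x | forall n, in_level n.+1 (x n) /\ esrc (x n) = erng (x n.+1)].

Definition initial (g : finpath) (x : nat -> bedge) : Prop :=
  frng g = erng (x 0%N) /\ fedges g = mkseq x (flen g).

Definition cylinder (g : finpath) : set (nat -> bedge) :=
  infpath `&` [set x | initial g x].

(* Meaningful for distinct infinite paths with the same range. *)
Definition meet (x y : nat -> bedge) : finpath :=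
  xget (fvertex (erng (x 0%N)))
    [set g | [/\ initial g x, initial g y &
       forall h, initial h x -> initial h y -> (flen h <= flen g)%N]].

End Bratteli.

Section Weights.
Variables (R : realType) (k : nat) (V : finType) (L : kgraph k V).

Definition is_weight (w : finpath L -> R) : Prop :=
  [/\ forall g, 0 < w g,
      \sum_v w (fvertex L v) <= 1,
      (fun n => sup [set w g | g in [set g | flen g = n]]) @ \oo --> (0 : R) &
      forall g l, proper_initial g l -> w l < w g].

Definition w_delta (delta : R) (g : finpath L) : R :=
  let q := (flen g %/ k)%N in let t := (flen g %% k)%N in
  ((\prod_(i < k | (i < t)%N) rho R L i ^+ q.+1) *
   (\prod_(i < k | (t <= i)%N) rho R L i ^+ q)) `^ (- delta^-1)
  * pf_vector R L (fsrc g).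

Definition d_delta (delta : R) (x y : nat -> bedge V) : R :=
  if `[< x = y >] then 0
  else if erng (x 0%N) == erng (y 0%N) then w_delta delta (meet L x y) else 1.

Definition diam (delta : R) (g : finpath L) : R :=
  sup [set r | exists x y,
    [/\ cylinder g x, cylinder g y & r = d_delta delta x y]].

End Weights.

Section Operators.
Variables (R : realType) (I : choiceType).
Notation C := R[i].
Implicit Types (f g : I -> C) (T : (I -> C) -> (I -> C)).

Definition l2sum f : \bar R :=
  \esum_(i in [set: I]) (Normc.normc (f i) ^+ 2)%:E.
Definition l2 : set (I -> C) := [set f | (l2sum f < +oo)%E].
Definition l2norm f : R := Num.sqrt (fine (l2sum f)).

(* [rsum] and [csum] are meaningful for absolutely summable families. *)
Definition rsum (a : I -> R) : R :=
  fine (\esum_(i in [set: I]) (Num.max (a i) 0)%:E)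
  - fine (\esum_(i in [set: I]) (Num.max (- a i) 0)%:E).
Definition csum (a : I -> C) : C :=
  rsum (fun i => complex.Re (a i)) +i* rsum (fun i => complex.Im (a i)).
(* Linear in the second argument *)
Definition inner f g : C := csum (fun i => (f i)^* * g i).

(* Operators are functions on all of [I -> C]; only their restriction to l^2
   matters. *)
Definition bounded_operator T : Prop :=
  [/\ forall f, l2 f -> l2 (T f),
      forall (a : C) f g, l2 f -> l2 g ->
        T (fun i => a * f i + g i) = (fun i => a * T f i + T g i) &
      exists M : R, forall f, l2 f -> l2norm (T f) <= M * l2norm f].

(* The image of the unit ball is totally bounded, i.e. relatively compact,
   l^2 being complete. *)
Definition compact_operator T : Prop :=
  bounded_operator T /\
  forall e : R, 0 < e -> exists m (c : 'I_m -> (I -> C)),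
    (forall j, l2 (c j)) /\
    forall f, l2 f -> l2norm f <= 1 ->
      exists j, l2norm (fun i => T f i - c j i) < e.

Definition positive_operator T : Prop :=
  forall f, l2 f -> 0 <= inner f (T f).

Definition has_dim (E : set (I -> C)) (m : nat) : Prop :=
  exists b : 'I_m -> (I -> C),
    [/\ forall j, E (b j),
        forall c : 'I_m -> C,
          (forall i, \sum_j c j * b j i = 0) -> forall j, c j = 0 &
        forall f, E f -> exists c : 'I_m -> C,
          forall i, f i = \sum_j c j * b j i].

(* The solutions of T^* T f = s^2 f, which is the eigenspace of |T| for the
   eigenvalue [s >= 0]; the adjoint is moved to the other side. *)
Definition abs_eigenspace T (s : R) : set (I -> C) :=
  [set f | l2 f /\
     forall g, l2 g -> inner (T g) (T f) = (s ^+ 2)%:C * inner g f].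

(* [sigma] is nonincreasing and lists the positive eigenvalues of |T|, each
   one as often as its multiplicity, and possibly zeros. *)
Definition is_singular_values T (sigma : nat -> R) : Prop :=
  [/\ forall n, 0 <= sigma n,
      forall m n, (m <= n)%N -> sigma n <= sigma m &
      forall s, 0 < s -> exists2 m, has_dim (abs_eigenspace T s) m
        & ([set n | sigma n = s] #= `I_m)%card].

(* Exists and is unique for compact operators *)
Definition singular_values T : nat -> R :=
  xget (fun=> 0) [set sigma | is_singular_values T sigma].

Definition dixmier_macaev T : Prop :=
  compact_operator T /\
  (limn_esup (fun n => ((ln n%:R)^-1 *
     \sum_(1 <= j < n.+1) singular_values T j)%:E) < +oo)%E.

(* Dilation-invariant states on l^oo(N) vanishing on c_0; restriction to
   real-valued sequences loses nothing, as a state is determined by it.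
   Sequences start at index 0, hence the m-fold dilation
   (u_0, ..., u_0, u_1, ..., u_1, ...) is [fun n => u (n %/ m)]. *)
Definition generalized_limit (omega : (nat -> R) -> R) : Prop :=
  [/\ forall (a : R) (u v : nat -> R), bounded_fun u -> bounded_fun v ->
        omega (fun n => a * u n + v n) = a * omega u + omega v,
      forall u : nat -> R, bounded_fun u -> (forall n, 0 <= u n) ->
        0 <= omega u,
      omega (fun=> 1) = 1,
      forall u : nat -> R, u @ \oo --> (0 : R) -> omega u = 0 &
      forall (u : nat -> R) (m : nat), bounded_fun u -> (0 < m)%N ->
        omega (fun n => u (n %/ m)%N) = omega u].

(* Meaningful for positive [T] only *)
Definition dixmier_trace omega T : R :=
  omega (fun n => (ln n.+2%:R)^-1 * \sum_(0 <= j < n.+1) singular_values T j).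

(* The positive operator [T] is Connes measurable, with Dixmier trace [c] *)
Definition has_dixmier_trace T (c : R) : Prop :=
  [/\ dixmier_macaev T, positive_operator T &
      forall omega, generalized_limit omega -> dixmier_trace omega T = c].

Definition connes_measurable T : Prop := exists c, has_dixmier_trace T c.

End Operators.

(* phi(A), for [A] normal: [spectralmx] and [spectral_diag] diagonalize [A]. *)
Definition mxcalc (R : realType) n (phi : R[i] -> R[i]) (A : 'M[R[i]]_n) :
    'M[R[i]]_n :=
  invmx (spectralmx A) *m diag_mx (map_mx phi (spectral_diag A))
    *m spectralmx A.

(* The direct sum of the 2 x 2 blocks [B c], acting on
   l^2(G, C^2) = l^2(G x {0, 1}) *)
Definition block_operator (R : realType) (G : choiceType)
    (B : G -> 'M[R[i]]_2) (f : G * 'I_2 -> R[i]) : G * 'I_2 -> R[i] :=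
  fun c => \sum_(j < 2) B c.1 c.2 j * f (c.1, j).

Section Dirac.
Variables (R : realType) (k : nat) (V : finType) (L : kgraph k V) (delta : R).

Definition dirac_block (g : finpath L) : 'M[R[i]]_2 :=
  ((diam delta g)^-1)%:C *: \matrix_(i < 2, j < 2) (i != j)%:R.

Definition dirac : (finpath L * 'I_2 -> R[i]) -> (finpath L * 'I_2 -> R[i]) :=
  block_operator dirac_block.

(* |D|^a, by functional calculus in each block of D *)
Definition dirac_abs_pow (a : R) :
    (finpath L * 'I_2 -> R[i]) -> (finpath L * 'I_2 -> R[i]) :=
  block_operator (fun g =>
    mxcalc (fun z => (Normc.normc z `^ a)%:C) (dirac_block g)).

End Dirac.

(* Main.v *)
Require Import Defs.
From mathcomp Require Import all_boot all_order all_algebra finmap.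
From mathcomp Require Import all_classical all_reals all_analysis.
From mathcomp Require Import complex.
From mathcomp Require Import spectral ring lra.
Set Implicit Arguments.
Unset Strict Implicit.
Unset Printing Implicit Defensive.
Import Order.TTheory GRing.Theory Num.Theory.
Import numFieldNormedType.Exports.
Local Open Scope classical_set_scope.
Local Open Scope ring_scope.

(** The operator |D|^-delta is diagonal, and by the definition of w_delta its
    eigenvalue at a path [g] of length [n] is [x (s g) ^ delta / a_n], where
    [a_n] is the product of the [rho_i] of the first [n] levels.  Since [x] is a
    common eigenvector of the adjacency matrices, there are about [a_n] such
    paths.  Over one period of [k] levels the eigenvalues therefore sum to
    [1^T P^q y] for a fixed vector [y] and a matrix [P >= 0] with [P x = x].
    [P] is power bounded, so [y = z + w - P w] with [P z = z] and the sum over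
    [q] periods is [c0 q + O(1)].  Sorting the eigenvalues only disturbs this by
    O(1): those beyond [q] periods are O(rho^-q), while [q] periods contain
    O(rho^q) paths, [rho] being the product of all [rho_i].  Hence the partial
    sums of the singular values, divided by the logarithm, converge to
    [c0 / ln rho], which every generalized limit must then return. *)

(** * Logarithmic averages and the mean ergodic theorem *)

(** Since [rho ^+ q] and [N q] agree up to constant factors, every [n] lies between two values of
    [N] whose indices differ from [ln n / ln rho] by O(1). Monotonicity of [S] then gives
    [S n = c0 / ln rho * ln n + O(1)]. *)
Lemma cvg_log_average (R : realType) (S : nat -> R) (N : nat -> nat)
    (rho c1 c2 c0 K : R) :
  1 < rho -> 0 < c1 -> 0 < c2 -> 0 <= c0 ->
  {homo S : m n / (m <= n)%N >-> m <= n} -> 0 <= S 0%N ->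
  (forall q, (0 < q)%N -> c1 * rho ^+ q <= (N q)%:R) ->
  (forall q, (N q)%:R <= c2 * rho ^+ q) ->
  (forall q, `|S (N q) - c0 * q%:R| <= K) ->
  (fun n => (ln n.+2%:R)^-1 * S n.+1) @ \oo --> c0 / ln rho.
Proof.
move=> rho1 c1_gt0 c2_gt0 c0_ge0 S_homo S0 N_ge N_le SN.
have rho_gt0 : 0 < rho by rewrite (lt_trans _ rho1).
have lnrho : 0 < ln rho by rewrite ln_gt0.
have K_ge0 : 0 <= K by rewrite (le_trans _ (SN 0%N)).
have S_ge0 n : 0 <= S n by rewrite (le_trans S0)// S_homo.
have lnX q : ln (rho ^+ q) = q%:R * ln rho by rewrite lnXn// mulr_natl.
pose l (n : nat) : R := ln n.+2%:R.
have l_gt0 n : 0 < l n by rewrite ln_gt0// ltr1n.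
(* the block index q closest to log_rho n from above, resp. from below *)
have Sup : exists K1, forall n, S n.+1 <= c0 / ln rho * l n + K1.
  pose b := `|ln c1| / ln rho.
  exists (c0 * (b + 1) + K) => n.
  pose y := l n / ln rho + b.
  have y_ge0 : 0 <= y by rewrite addr_ge0// divr_ge0// ltW.
  have /andP[qy yq] := truncn_itv y_ge0.
  set q := (Num.truncn y).+1 in yq.
  have : n.+2%:R <= c1 * rho ^+ q.
    rewrite -ler_ln ?posrE ?ltr0n// ?mulr_gt0 ?exprn_gt0//.
    rewrite lnM ?posrE ?exprn_gt0// lnX.
    have : y * ln rho <= q%:R * ln rho by rewrite ler_pM2r// ltW.
    rewrite mulrDl !divfK ?gt_eqF// -/(l n) => H.
    have : - ln c1 <= `|ln c1| by rewrite -normrN ler_norm.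
    lra.
  move=> /le_trans/(_ (N_ge q isT)); rewrite ler_nat => nN.
  apply: (le_trans (S_homo _ _ (ltnW nN))).
  have := SN q; rewrite ler_norml => /andP[_]; rewrite lerBlDr => /le_trans; apply.
  have : c0 * q%:R <= c0 * (y + 1).
    by rewrite ler_wpM2l// /q -natr1 lerD2r.
  rewrite /y => H; rewrite addrC addrA lerD2r (le_trans H)//.
  by rewrite -mulrA [(ln rho)^-1 * _]mulrC -mulrDr addrA.
have Slo : exists K2, forall n, c0 / ln rho * l n - K2 <= S n.+1.
  (* The term [ln 2] pays for passing from [n.+2] under the logarithm to [n.+1] terms of the sum. *)
  pose b := (`|ln c2| + ln 2) / ln rho.
  have b_ge0 : 0 <= b.
    by rewrite divr_ge0 ?addr_ge0 ?(ltW lnrho)// ltW// ln_gt0// ltr1n.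
  exists (c0 * (b + 1) + K) => n.
  pose y := l n / ln rho - b.
  have E : c0 / ln rho * l n - (c0 * (b + 1) + K) = c0 * (y - 1) - K.
    by rewrite /y; ring.
  (* For negative [y] no block fits below [n], but then the claimed lower bound is nonpositive. *)
  rewrite E; have [y_ge0|y_lt0] := leP 0 y; last first.
    rewrite (le_trans _ (S_ge0 _))// -oppr_ge0 opprB subr_ge0.
    rewrite (le_trans _ K_ge0)// mulr_ge0_le0//; lra.
  have /andP[qy yq] := truncn_itv y_ge0.
  set q := Num.truncn y in qy yq.
  have Nn : (N q)%:R <= n.+1%:R :> R.
    apply: (le_trans (N_le q)).
    rewrite -ler_ln ?posrE ?ltr0n// ?mulr_gt0 ?exprn_gt0//.
    rewrite lnM ?posrE ?exprn_gt0// lnX.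
    have : q%:R * ln rho <= y * ln rho by rewrite ler_pM2r.
    rewrite mulrBl !divfK ?gt_eqF// => H.
    have : l n <= ln 2 + ln n.+1%:R.
      rewrite -lnM ?posrE ?ltr0n// ler_ln ?posrE ?ltr0n// ?mulr_gt0 ?ltr0n//.
      by rewrite -natrM ler_nat mul2n -addnn addSn ltnS addnS ltnS leq_addl.
    have : ln c2 <= `|ln c2| by rewrite ler_norm.
    lra.
  rewrite ler_nat in Nn; apply: le_trans (S_homo _ _ Nn).
  have := SN q; rewrite ler_norml => /andP[]; rewrite lerBrDr addrC => + _.
  apply: le_trans; rewrite lerD2r ler_wpM2l//.
  by rewrite lerBlDr natr1 ltW.
have [K1 {}Sup] := Sup; have [K2 {}Slo] := Slo.
pose K' := `|K1| + `|K2|.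
have bnd n : `|(l n)^-1 * S n.+1 - c0 / ln rho| <= K' * (l n)^-1.
  have E : (l n)^-1 * S n.+1 - c0 / ln rho = (S n.+1 - c0 / ln rho * l n) * (l n)^-1.
    by rewrite mulrBl mulfK ?gt_eqF// [_ * S _]mulrC.
  rewrite E normrM [X in _ * X]gtr0_norm ?invr_gt0// ler_pM2r ?invr_gt0//.
  have := Sup n; have := Slo n; have := ler_norm K1; have := ler_norm K2.
  have := normr_ge0 K1; have := normr_ge0 K2.
  by rewrite /K' ler_norml => *; apply/andP; split; lra.
have K'l : (fun n => K' * (l n)^-1) @ \oo --> (0 : R).
  rewrite -[0](mulr0 K'); apply: cvgM; first exact: cvg_cst.
  apply/(@gtr0_cvgV0 R nat \oo _ l); first by near=> n; exact: l_gt0.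
  apply/cvgryPge => A; near=> n.
  rewrite /l -[leLHS]expRK ler_ln ?posrE ?expR_gt0 ?ltr0n//.
  rewrite (@le_trans _ _ n%:R) ?ler_nat// ?(leqW (leqnSn n))//.
  by near: n; exact: nbhs_infty_ger.
apply: (@squeeze_cvgr _ _ _ _ (fun n => c0 / ln rho - K' * (l n)^-1)
    (fun n => c0 / ln rho + K' * (l n)^-1) _).
- near=> n; have := bnd n; rewrite ler_norml => /andP[].
  rewrite lerBrDr addrC => lo hi; apply/andP; split; last by rewrite -lerBlDl.
  exact: lo.
- by rewrite -[X in _ --> X]subr0; apply: cvgB => //; exact: cvg_cst.
- by rewrite -[X in _ --> X]addr0; apply: cvgD => //; exact: cvg_cst.
Unshelve. all: by end_near. Qed.

(* Power boundedness makes the kernel and the range of [1 - P] meet trivially,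
   so [(1 - P)^2] has the rank of [1 - P] and [(1 - P) y = (1 - P)^2 w] is
   solvable. *)
Lemma mean_ergodic (R : archiRealFieldType) n (P : 'M[R]_n) :
  (forall y : 'cV_n, exists C, forall q i, `|(P ^+ q *m y) i 0| <= C) ->
  forall y : 'cV_n, exists z w : 'cV_n, P *m z = z /\ y = z + (w - P *m w).
Proof.
move=> Pbnd y; pose M := 1%:M - P.
have ME (u : 'cV_n) : M *m u = u - P *m u by rewrite mulmxBl mul1mx.
have ker2 (u : 'cV_n) : M *m (M *m u) = 0 -> M *m u = 0.
  move=> MMu; set z := M *m u in MMu *.
  have Pz : P *m z = z by move/eqP: MMu; rewrite ME subr_eq0 => /eqP.
  (* Since [z] is fixed by [P], the orbit of [u] drifts linearly along [z]; boundedness forces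
     [z = 0]. *)
  have Pqu q : u - P ^+ q *m u = z *+ q.
    elim: q => [|q IH]; first by rewrite expr0 mul1mx subrr.
    have Pqz : P ^+ q *m z = z.
      elim: q {IH} => [|q IH]; first by rewrite expr0 mul1mx.
      by rewrite exprSr -mulmxE -mulmxA Pz.
    have := congr1 (mulmx (P ^+ q)) (ME u).
    rewrite -/z Pqz mulmxBr mulmxA mulmxE -exprSr => E.
    by rewrite mulrS -IH {1}E addrC subrKA.
  have [C HC] := Pbnd u.
  apply/matrixP => i j; rewrite ord1 !mxE; apply/eqP/negPn/negP => z_neq0.
  have z_gt0 : 0 < `|z i 0| by rewrite normr_gt0 !mxE.
  have Cq q : `|z i 0| *+ q <= C + C.
    rewrite -normrMn.
    have -> : z i 0 *+ q = (z *+ q) i 0 by rewrite mulmxnE.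
    rewrite -Pqu mxE.
    rewrite (le_trans (ler_normD _ _))// lerD//.
      by have := HC 0%N i; rewrite expr0 mul1mx.
    by rewrite mxE normrN.
  have C_ge0 : 0 <= C + C by have := Cq 0%N.
  have := archi_boundP (divr_ge0 C_ge0 (ltW z_gt0)).
  by rewrite ltr_pdivrMr// mulr_natl ltNge Cq.
(* [kermx] and row-space inclusion concern row vectors, so the rank argument is run on the
   transpose. *)
pose A := M^T.
have capA : (A :&: kermx A)%MS = 0.
  apply/eqP/rowV0P => v; rewrite sub_capmx => /andP[/submxP[D ->]].
  move/sub_kermxP => DAA.
  suff : M *m D^T = 0 by move/(congr1 trmx); rewrite trmx_mul trmxK trmx0.
  by apply: ker2; apply: trmx_inj; rewrite !trmx_mul trmxK trmx0 -/A DAA.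
have rkA : \rank (A *m A) = \rank A.
  by have := mxrank_mul_ker A A; rewrite capA mxrank0 addn0.
have sAA : (A <= A *m A)%MS.
  by rewrite -(geq_leqif (mxrank_leqif_sup (submxMl A A))) rkA.
have /submxP[D DE] : (y^T *m A <= A *m A)%MS by rewrite (submx_trans (submxMl _ _)).
exists (y - M *m D^T), D^T; split; last by rewrite -ME subrK.
apply/eqP; rewrite eq_sym -subr_eq0 -ME mulmxBr subr_eq0; apply/eqP.
have := congr1 trmx DE; rewrite !trmx_mul !trmxK => ->.
by rewrite mulmxA.
Qed.

(** The coboundary [w - P *m w] telescopes and the fixed vector [z] contributes itself at each step;
    for power bounded [P] the sum is thus linear in [q] up to O(1). *)
Lemma sum_mean_ergodic (R : archiRealFieldType) n (P : 'M[R]_n) (z w : 'cV_n) q :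
  P *m z = z ->
  \sum_(0 <= p < q) P ^+ p *m (z + (w - P *m w)) = z *+ q + (w - P ^+ q *m w).
Proof.
move=> Pz; elim: q => [|q IH].
  by rewrite big_geq// expr0 mul1mx subrr addr0.
have Pqz : P ^+ q *m z = z.
  elim: q {IH} => [|q IH]; first by rewrite expr0 mul1mx.
  by rewrite exprSr -mulmxE -mulmxA Pz.
rewrite big_nat_recr//= IH mulmxDr Pqz mulmxBr mulmxA mulmxE -exprSr.
rewrite mulrSr -!addrA; congr (_ + _).
by rewrite [RHS]addrCA; congr (_ + _); rewrite addrCA addKr.
Qed.

(** * Diagonal operators on l^2 and their singular values *)

Section Esum.
Variables (R : realType) (I : choiceType).
Implicit Types (a : I -> R) (f g : I -> R[i]).

Lemma esum_finsupp a (s : seq I) : uniq s -> (forall i, 0 <= a i) ->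
  (forall i, i \notin s -> a i = 0) ->
  (\esum_(i in [set: I]) (a i)%:E)%E = (\sum_(i <- s) a i)%:E.
Proof.
move=> us a0 as0.
have -> : (\esum_(i in [set: I]) (a i)%:E = \esum_(i in [set` s]) (a i)%:E)%E.
  rewrite [RHS]esum_mkcond; apply: eq_esum => i _; case: ifPn => // /negP.
  by rewrite inE /= => /negP /as0 ->.
rewrite esum_fset//; last by move=> i _; rewrite lee_fin.
rewrite fsbig_finite//= sumEFin; congr _%:E; apply: perm_big.
rewrite uniq_perm// => i.
by rewrite in_fset_set// mem_setE.
Qed.

Lemma esumZl (c : R) (b : I -> \bar R) : 0 <= c -> (forall i, (0 <= b i)%E) ->
  (\esum_(i in [set: I]) (c%:E * b i) = c%:E * \esum_(i in [set: I]) b i)%E.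
Proof.
(* One inequality suffices: for [c] nonzero the reverse one is the same statement for [c^-1]. *)
have half (d : R) (h : I -> \bar R) : 0 <= d -> (forall i, (0 <= h i)%E) ->
    (\esum_(i in [set: I]) (d%:E * h i) <= d%:E * \esum_(i in [set: I]) h i)%E.
  move=> d0 h0; apply: ge_ereal_sup => _ [X [finX _]] <-.
  rewrite fsbig_finite//= -ge0_sume_distrr//.
  rewrite lee_wpmul2l// esum_ge//; exists X => //.
  by rewrite fsbig_finite.
move=> c0 b0; have [->|c_neq0] := eqVneq c 0.
  by rewrite mul0e esum1// => i _; rewrite mul0e.
apply/eqP; rewrite eq_le half//=.
have cV0 : 0 <= c^-1 by rewrite invr_ge0.
have := half c^-1 (fun i => c%:E * b i)%E cV0.
rewrite (eq_esum (b := b)); last by move=> i _; rewrite muleA -EFinM mulVf// mul1e.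
move=> H; rewrite -[leRHS]mul1e -(divff c_neq0) EFinM -muleA lee_wpmul2l//.
by apply: H => i; rewrite mule_ge0.
Qed.

(** Serves the compactness proof: [s] holds the coordinates approximated with squared error [c], and
    [b] dominates the tail. *)
Lemma esum_le_finsupp_add a (b : I -> R) (s : seq I) (c : R) :
  uniq s -> (forall i, 0 <= b i) -> (forall i, 0 <= a i) -> 0 <= c ->
  (forall i, i \in s -> a i <= c) -> (forall i, i \notin s -> a i <= b i) ->
  (\esum_(i in [set: I]) (a i)%:E <=
    (c *+ size s)%:E + \esum_(i in [set: I]) (b i)%:E)%E.
Proof.
move=> us b0 a0 c0 asc ab.
have -> : (c *+ size s)%:E =
    (\esum_(i in [set: I]) (if i \in s then c else 0)%:E)%E.
  rewrite (@esum_finsupp _ s)//.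
  - by rewrite -big_mkcond -big_seq big_const_seq count_predT iter_addr_0.
  - by move=> i; case: ifP.
  - by move=> i /negPf ->.
rewrite -esumD; last 2 first.
- by move=> i _; rewrite lee_fin; case: ifP.
- by move=> i _; rewrite lee_fin.
apply: le_esum => i _; rewrite -EFinD lee_fin; case: ifPn => [/asc|/ab].
  by move/le_trans; apply; rewrite lerDl.
by rewrite add0r.
Qed.

Lemma rsum_finsupp a (s : seq I) : uniq s -> (forall i, i \notin s -> a i = 0) ->
  rsum a = \sum_(i <- s) a i.
Proof.
move=> us as0; rewrite /rsum.
rewrite (@esum_finsupp (fun i => Num.max (a i) 0) s)//; last 2 first.
- by move=> i; rewrite le_max lexx orbT.
- by move=> i /as0 ->; rewrite maxxx.
rewrite (@esum_finsupp (fun i => Num.max (- a i) 0) s)//; last 2 first.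
- by move=> i; rewrite le_max lexx orbT.
- by move=> i /as0 ->; rewrite oppr0 maxxx.
rewrite /= -sumrB; apply: eq_bigr => i _.
have /orP[a0|a0] := le_total 0 (a i).
  by rewrite (max_l a0) max_r ?subr0// oppr_le0.
by rewrite (max_r a0) max_l ?sub0r ?opprK// oppr_ge0.
Qed.

Lemma csum_finsupp f (s : seq I) : uniq s -> (forall i, i \notin s -> f i = 0) ->
  csum f = \sum_(i <- s) f i.
Proof.
move=> us fs0; rewrite /csum.
rewrite !(rsum_finsupp us); try by move=> i /fs0 ->.
elim: (s) => [|i l IH]; first by rewrite !big_nil.
rewrite !big_cons -IH; case: (f i) => x y /=.
by apply/eqP; rewrite eq_complex /= !eqxx.
Qed.

(** The basis vector of l^2 at [i]; the name refers to the Dirac delta, not to the Dirac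
    operator. *)
Definition dirac_fun (i : I) : I -> R[i] := fun j => (j == i)%:R.

Lemma l2_finsupp f (s : seq I) : uniq s -> (forall i, i \notin s -> f i = 0) ->
  l2 f.
Proof.
move=> us fs0; rewrite /l2 /= /l2sum.
rewrite (@esum_finsupp (fun i => Normc.normc (f i) ^+ 2) s)//.
- by rewrite ltry.
- by move=> i; rewrite sqr_ge0.
- by move=> i /fs0 ->; rewrite Normc.normc0 expr0n.
Qed.

Lemma l2_dirac_fun i : l2 (dirac_fun i).
Proof.
apply: (@l2_finsupp _ [:: i]) => // j; rewrite inE /dirac_fun => /negPf ->//.
Qed.

Lemma inner_singleton i f g : (forall j, j != i -> f j = 0) ->
  inner f g = (f i)^* * g i.
Proof.
move=> f0; rewrite /inner (@csum_finsupp _ [:: i])// ?big_seq1// => j.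
by rewrite inE => /f0 ->; rewrite conjC0 mul0r.
Qed.

Lemma l2sum_ge0 f : (0 <= l2sum f)%E.
Proof. by apply: esum_ge0 => i _; rewrite lee_fin sqr_ge0. Qed.

Lemma l2_fin_num f : l2 f -> l2sum f \is a fin_num.
Proof. by move=> fl2; rewrite ge0_fin_numE ?l2sum_ge0. Qed.

Lemma l2sum_le1 f : l2 f -> l2norm f <= 1 -> (l2sum f <= 1)%E.
Proof.
move=> fl2; rewrite /l2norm -(fineK (l2_fin_num fl2)) lee_fin.
by rewrite -{1}sqrtr1 ler_sqrt.
Qed.

Lemma normc_le_l2sum f i : ((Normc.normc (f i) ^+ 2)%:E <= l2sum f)%E.
Proof.
apply: esum_ge; exists [set i]; first by split.
by rewrite fsbig_set1.
Qed.

End Esum.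

(** Expanding a free family in a spanning one gives a matrix with independent rows, whose rank is at
    most its number of columns. *)
Lemma has_dim_leq (R : realType) (I : choiceType) (E : set (I -> R[i])) m m' :
  has_dim E m -> has_dim E m' -> (m <= m')%N.
Proof.
case=> b [bE b_free _] [b' [_ _ b'_span]].
have [M bM] := choice (fun j => b'_span _ (bE j)).
pose A : 'M[R[i]]_(m, m') := \matrix_(j, l) M j l.
suff : row_free A by move=> /eqP <-; exact: rank_leq_col.
apply/inj_row_free => v vA.
apply/matrixP => r j; rewrite (ord1 r) !mxE.
apply: (b_free (fun j => v 0 j)) => i.
under eq_bigr do rewrite bM mulr_sumr.
rewrite exchange_big /= big1// => l _.
under eq_bigr do rewrite mulrA.
rewrite -mulr_suml.
have := congr1 (fun B : 'rV_m' => B 0 l) vA; rewrite !mxE => H.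
rewrite (eq_bigr (fun j => v 0 j * A j l)) ?H ?mul0r// => j' _.
by rewrite mxE.
Qed.

Lemma has_dim_unique (R : realType) (I : choiceType) (E : set (I -> R[i])) m m' :
  has_dim E m -> has_dim E m' -> m = m'.
Proof. by move=> Em Em'; apply/eqP; rewrite eqn_leq !(@has_dim_leq _ _ E). Qed.

Lemma has_dim_finsupp (R : realType) (I : choiceType) (s : seq I) : uniq s ->
  has_dim [set f : I -> R[i] | forall i, i \notin s -> f i = 0] (size s).
Proof.
move=> us; pose t := in_tuple s.
have tI (j l : 'I_(size s)) : (tnth t l == tnth t j) = (l == j).
  by have x0 := tnth t l; rewrite !(tnth_nth x0) nth_uniq.
exists (fun j => @dirac_fun R I (tnth t j)); split.
- move=> j i /=; apply: contraNeq; rewrite /dirac_fun.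
  by have [->|] := eqVneq i; [rewrite mem_tnth|rewrite eqxx].
- move=> c cE j; have := cE (tnth t j).
  rewrite (bigD1 j)//= /dirac_fun eqxx mulr1 big1 ?addr0// => l lj.
  by rewrite tI eq_sym (negPf lj) mulr0.
- move=> f fs; exists (fun j => f (tnth t j)) => i.
  have [/tnthP[j ->]|si] := boolP (i \in t); last first.
    rewrite fs// big1// => j _; rewrite /dirac_fun.
    by case: eqP => [ij|]; [rewrite ij mem_tnth in si|rewrite mulr0].
  rewrite (bigD1 j)//= /dirac_fun eqxx mulr1 big1 ?addr0// => l lj.
  by rewrite tI eq_sym (negPf lj) mulr0.
Qed.

Lemma ler_sum_uniq_sub (R : numDomainType) (I : eqType) (s1 s2 : seq I)
    (f : I -> R) :
  uniq s1 -> uniq s2 -> {subset s1 <= s2} -> (forall i, 0 <= f i) ->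
  \sum_(i <- s1) f i <= \sum_(i <- s2) f i.
Proof.
move=> u1 u2 s12 f0; rewrite [leRHS](bigID (mem s1))/=.
rewrite (_ : \sum_(i <- s2 | i \in s1) f i = \sum_(i <- s1) f i).
  by rewrite lerDl sumr_ge0.
rewrite -big_filter; apply: perm_big; apply: uniq_perm => //.
  exact: filter_uniq.
by move=> i; rewrite mem_filter; case: (boolP (i \in s1)) => //= /s12.
Qed.

(** * Decreasing rearrangement of a positive family tending to 0 *)

Section Rearrangement.
Variables (R : realType) (I : choiceType) (lam : I -> R).
Hypothesis lam_gt0 : forall i, 0 < lam i.
Hypothesis lam_finite : forall s, 0 < s -> finite_set [set i | s <= lam i].

(** For any [i0] outside [s], the indices with [lam] at least [lam i0] are finitely many, so a
    maximum among those outside [s] is a maximum over the whole complement. *)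
Lemma max_outside (s : seq I) : infinite_set [set: I] ->
  exists i, i \notin s /\ forall j, j \notin s -> lam j <= lam i.
Proof.
move=> I_infinite.
have [i0 i0s] : exists i, i \notin s.
  apply: contrapT => /forallNP H; apply: I_infinite.
  apply: (@sub_finite_set _ _ [set` s]); last exact: finite_seq.
  by move=> i _ /=; have /negP := H i; rewrite negbK.
have /finite_seqP[r rE] := lam_finite (lam_gt0 i0).
pose r' := [seq i <- r | i \notin s].
have i0r' : i0 \in r'.
  rewrite mem_filter i0s/=.
  by have : [set` r] i0 by rewrite -rE /=.
have argmax (l : seq I) b : b \in l ->
    exists2 i, i \in l & forall j, j \in l -> lam j <= lam i.
  elim: l b => // a l IH b _.
  have [l0|[c cl]] : l = [::] \/ exists c, c \in l.
    by case: (l) => [|c l']; [left|right; exists c; rewrite inE eqxx].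
    by rewrite l0; exists a; rewrite ?inE// => j; rewrite inE => /eqP ->.
  have [i il imax] := IH _ cl.
  have [ai|/ltW ia] := leP (lam a) (lam i).
    exists i; first by rewrite inE il orbT.
    by move=> j; rewrite inE => /predU1P[->|/imax].
  exists a; first by rewrite inE eqxx.
  by move=> j; rewrite inE => /predU1P[->|/imax/le_trans->].
have [i ir' imax] := argmax _ _ i0r'; exists i; split=> [|j js].
  by move: ir'; rewrite mem_filter => /andP[].
have [i0j|/ltW ji0] := leP (lam i0) (lam j).
  apply: imax; rewrite mem_filter js/=.
  by have : [set` r] j by rewrite -rE /=.
exact: le_trans ji0 (imax _ i0r').
Qed.

(** Greedy choice: [e n] maximizes [lam] among the indices not yet taken. *)
Lemma decreasing_enumeration : infinite_set [set: I] ->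
  exists e : nat -> I, [/\ injective e, forall i, exists n, e n = i
    & forall m n, (m <= n)%N -> lam (e n) <= lam (e m)].
Proof.
move=> I_infinite.
have [next nextP] := choice (fun s => max_outside s I_infinite).
pose l n := iter n (fun s => rcons s (next s)) [::].
pose e n := next (l n).
have lE n : l n = mkseq e n.
  elim: n => // n IH; rewrite /mkseq -[in iota _ _]addn1 iotaD map_cat cats1 add0n.
  by rewrite -/(mkseq e n) -IH.
have e_new n : e n \notin mkseq e n by rewrite -lE; have [] := nextP (l n).
have e_max n j : j \notin mkseq e n -> lam j <= lam (e n).
  by rewrite -lE; have [_] := nextP (l n); apply.
have ltn_neq m n : (m < n)%N -> e m <> e n.
  move=> mn emn; have := e_new n; rewrite -emn => /negP; apply.
  by apply/mapP; exists m => //; rewrite mem_iota.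
have e_inj : injective e.
  by move=> m n emn; case: (ltngtP m n) => // /ltn_neq; rewrite emn.
exists e; split => //.
- move=> i; apply: contrapT => /forallNP i_new.
  have /finite_seqP[r rE] := lam_finite (lam_gt0 i).
  (* An index [i] never chosen would be a competitor at every stage, so all the chosen indices would
     lie in the finite set where [lam] is at least [lam i]. *)
  have : {subset mkseq e (size r).+1 <= r}.
    move=> _ /mapP[n _ ->].
    suff : [set` r] (e n) by [].
    rewrite -rE /= e_max//; apply/negP => /mapP[p _ /esym]; exact: i_new.
  move/(uniq_leq_size _); rewrite size_mkseq ltnn => H; apply/notF/H.
  by rewrite map_inj_uniq ?iota_uniq.
- move=> m n mn; apply: e_max.
  apply/negP => /mapP[p]; rewrite mem_iota add0n => /= pm /e_inj np.
  by rewrite -np ltnNge mn in pm.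
Qed.

Variable e : nat -> I.
Hypothesis e_inj : injective e.
Hypothesis e_homo : forall m n, (m <= n)%N -> lam (e n) <= lam (e m).

(** Both sums have equally many terms, so the threshold [t = lam (e N)] may be subtracted from each.
    The positive part of [lam - t] vanishes off the first [N] indices and equals [lam - t] on
    them. *)
Lemma sum_le_rearrangement (s : seq I) : (forall i, exists n, e n = i) ->
  uniq s -> \sum_(i <- s) lam i <= \sum_(0 <= j < size s) lam (e j).
Proof.
move=> e_surj us; set N := size s; pose t := lam (e N).
pose f i := Num.max (lam i - t) 0.
have f0 i : 0 <= f i by rewrite le_max lexx orbT.
have -> : \sum_(0 <= j < N) lam (e j) = \sum_(i <- mkseq e N) lam i.
  by rewrite big_map /index_iota subn0.
have shift (r : seq I) : \sum_(i <- r) (lam i - t) = \sum_(i <- r) lam i - t *+ size r.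
  by rewrite sumrB big_const_seq count_predT iter_addr_0.
have uN : uniq (mkseq e N) by rewrite map_inj_uniq ?iota_uniq.
rewrite -(lerD2r (- (t *+ N))) -{1}/N -shift.
rewrite -[X in _ - t *+ X](size_mkseq e N) -shift.
apply: (@le_trans _ _ (\sum_(i <- s) f i)).
  by apply: ler_sum => i _; rewrite le_max lexx.
apply: (@le_trans _ _ (\sum_(i <- mkseq e N) f i)); last first.
  rewrite !big_map big_seq [leRHS]big_seq; apply: ler_sum => i.
  rewrite mem_iota add0n => /andP[_ iN].
  by rewrite /f max_l// subr_ge0 e_homo// ltnW.
rewrite (bigID (mem (mkseq e N)))/= [X in _ + X]big1 ?addr0; last first.
  move=> i; have [n <-] := e_surj i => eN.
  apply: max_r; rewrite subr_le0 e_homo// leqNgt; apply: contra eN => nN.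
  by apply/mapP; exists n => //; rewrite mem_iota.
rewrite -big_filter; apply: ler_sum_uniq_sub => //; first exact: filter_uniq.
by move=> i; rewrite mem_filter => /andP[].
Qed.

(** Among the first [N] indices, those in [s] contribute at most the sum over [s], and each of the
    others at most [t]. *)
Lemma rearrangement_le_sum (s : seq I) (t : R) N : uniq s -> 0 <= t ->
  (forall i, i \notin s -> lam i <= t) ->
  \sum_(0 <= j < N) lam (e j) <= \sum_(i <- s) lam i + t *+ N.
Proof.
move=> us t0 st.
have -> : \sum_(0 <= j < N) lam (e j) = \sum_(i <- mkseq e N) lam i.
  by rewrite big_map /index_iota subn0.
rewrite (bigID (mem s))/= lerD//.
  rewrite -big_filter; apply: ler_sum_uniq_sub => //.
  - by rewrite filter_uniq// map_inj_uniq ?iota_uniq.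
  - by move=> i; rewrite mem_filter => /andP[].
  - by move=> i; exact: ltW.
rewrite (le_trans (ler_sum _ (fun i => st i)))//.
rewrite big_const_seq iter_addr_0 ler_wpMn2l//.
by rewrite (leq_trans (count_size _ _))// size_mkseq.
Qed.

End Rearrangement.

(** At a first disagreement with [g n < f n], all occurrences of the value [f n] in [g] come before
    [n], where [f] and [g] agree; so [f] takes this positive value at least once more than [g]. This
    makes singular values unique. *)
Lemma nonincreasing_multiplicity_inj (R : realType) (u v : nat -> R) :
  (forall n, 0 <= u n) -> (forall n, 0 <= v n) ->
  (forall m n, (m <= n)%N -> u n <= u m) ->
  (forall m n, (m <= n)%N -> v n <= v m) ->
  (forall s, 0 < s -> exists m, ([set n | u n = s] #= `I_m)%card /\
                                ([set n | v n = s] #= `I_m)%card) ->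
  u = v.
Proof.
have half (f g : nat -> R) n : (forall n, 0 <= g n) ->
    (forall m n, (m <= n)%N -> g n <= g m) ->
    (forall s, 0 < s -> exists m, ([set n | f n = s] #= `I_m)%card /\
                                  ([set n | g n = s] #= `I_m)%card) ->
    (forall m, (m < n)%N -> f m = g m) -> f n <= g n.
  move=> g0 g_homo fg eq_lt; rewrite leNgt; apply/negP => gf.
  have f_gt0 : 0 < f n by rewrite (le_lt_trans (g0 n)).
  have [m [fm gm]] := fg _ f_gt0.
  have finf : finite_set [set p | f p = f n] by apply/finite_setP; exists m.
  have fing : finite_set [set p | g p = f n] by apply/finite_setP; exists m.
  have /fproper_ltn_card : (fset_set [set p | g p = f n] `<`
      fset_set [set p | f p = f n])%fset.
    rewrite fproperE; apply/andP; split.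
      apply/fsubsetP => p; rewrite !in_fset_set// !inE /= => gpn.
      have [pn|np] := ltnP p n; first by rewrite eq_lt.
      by have := g_homo _ _ np; rewrite gpn leNgt gf.
    apply/negP => /fsubsetP/(_ n); rewrite !in_fset_set// !inE /= => /(_ erefl) gfn.
    by rewrite gfn ltxx in gf.
  by rewrite (card_fset_set fm) (card_fset_set gm) ltnn.
move=> u0 v0 u_homo v_homo uv; apply/funext => n.
elim/ltn_ind: n => n IH; apply/eqP; rewrite eq_le; apply/andP; split.
  exact: half.
apply: half => // [s /uv[m [um vm]]|m /IH//]; first by exists m.
Qed.

Definition diag_operator (R : realType) (I : choiceType) (lam : I -> R)
    (f : I -> R[i]) : I -> R[i] := fun i => (lam i)%:C%C * f i.

Section DiagOperator.
Variables (R : realType) (I : choiceType) (lam : I -> R).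
Hypothesis lam_gt0 : forall i, 0 < lam i.
Hypothesis lam_finite : forall s, 0 < s -> finite_set [set i | s <= lam i].

Local Notation T := (diag_operator lam).

Lemma normcR (x : R) : Normc.normc x%:C%C = `|x|.
Proof. by rewrite /Normc.normc /= expr0n addr0 sqrtr_sqr. Qed.

Lemma normc_diag f i : Normc.normc (T f i) = lam i * Normc.normc (f i).
Proof. by rewrite Normc.normcM normcR gtr0_norm. Qed.

Lemma lam_bounded : exists2 M, 0 <= M & forall i, lam i <= M.
Proof.
have /finite_seqP[r rE] := lam_finite ltr01.
have sum_ge0 (s : seq I) : 0 <= \sum_(j <- s) lam j.
  by apply: sumr_ge0 => j _; exact: ltW.
exists (1 + \sum_(j <- r) lam j); first by rewrite addr_ge0.
move=> i; have [lam1|/ltW lam1] := leP 1 (lam i); last first.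
  by rewrite (le_trans lam1)// lerDl.
have : i \in r by have : [set` r] i by rewrite -rE.
elim: r {rE} => // j r IH; rewrite inE big_cons => /predU1P[<-|/IH].
  by rewrite addrCA lerDl addr_ge0.
by move=> /le_trans; apply; rewrite lerD2l lerDr ltW.
Qed.

Lemma l2sum_diag_le f (M : R) : 0 <= M -> (forall i, lam i <= M) ->
  (l2sum (T f) <= (M ^+ 2)%:E * l2sum f)%E.
Proof.
move=> M0 lamM; rewrite /l2sum -esumZl ?sqr_ge0//; last first.
  by move=> i; rewrite lee_fin sqr_ge0.
apply: le_esum => i _; rewrite -EFinM lee_fin normc_diag exprMn.
rewrite ler_wpM2r ?sqr_ge0// lerXn2r ?nnegrE//.
exact: ltW.
Qed.

Lemma bounded_diag : bounded_operator T.
Proof.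
have [M M0 lamM] := lam_bounded.
have Tl2 f : l2 f -> l2 (T f).
  move=> fl2; rewrite /l2 /= (le_lt_trans (l2sum_diag_le _ M0 lamM))//.
  by rewrite -(fineK (l2_fin_num fl2)) -EFinM ltry.
split => //.
- move=> a f g _ _; apply/funext => i; rewrite /diag_operator; ring.
- exists M => f fl2; rewrite /l2norm -{1}(ger0_norm M0) -sqrtr_sqr.
  rewrite -sqrtrM ?sqr_ge0// ler_wsqrtr// -lee_fin EFinM.
  by rewrite !fineK ?l2_fin_num//; [exact: l2sum_diag_le|exact: Tl2].
Qed.

(** Rounding down to the grid of mesh [h] that starts at [- M]; it quantizes real and imaginary
    parts in the finite net below. *)
Lemma grid_approximation (M h x : R) : 0 < h -> `|x| <= M ->
  let k := Num.truncn ((x + M) / h) in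
  (k < Num.Def.archi_bound ((M + M) / h))%N /\ `|x - (k%:R * h - M)| <= h.
Proof.
move=> h0; rewrite ler_norml => /andP[Mx xM] k.
have y0 : 0 <= (x + M) / h by rewrite divr_ge0 ?(ltW h0)//; lra.
have /andP[ky yk] := truncn_itv y0; rewrite -/k in ky yk.
split.
  rewrite -(ltr_nat R) (le_lt_trans ky)//.
  rewrite (@le_lt_trans _ _ ((M + M) / h))//.
    by rewrite ler_pM2r ?invr_gt0//; lra.
  by apply: archi_boundP; rewrite divr_ge0 ?(ltW h0)//; lra.
rewrite ler_pdivlMr// in ky; rewrite ltr_pdivrMr// mulrSr mulrDl mul1r in yk.
by rewrite ler_norml; apply/andP; split; lra.
Qed.

(* A finite net for the image of the unit ball: coordinates with [lam i]
   above the threshold take values in a finite grid, the others are 0. *)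
Lemma compact_diag : compact_operator T.
Proof.
split; first exact: bounded_diag.
move=> e e0; have [M M0 lamM] := lam_bounded.
pose t := e / 2; have t0 : 0 < t by rewrite divr_gt0.
have finA := lam_finite t0.
pose s : seq I := fset_set [set i | t <= lam i].
have sE i : (i \in s) = (t <= lam i).
  by rewrite in_fset_set//; apply/idP/idP; rewrite inE.
have us : uniq s by exact: fset_uniq.
(* With this mesh the coordinates in [s] contribute at most [e ^+ 2 / 4] to the squared distance,
   and the tail at most [t ^+ 2 = e ^+ 2 / 4]. *)
pose h := e / (4 * (size s).+1%:R).
have h0 : 0 < h by rewrite divr_gt0// mulr_gt0.
pose K := Num.Def.archi_bound ((M + M) / h).
pose net (phi : {ffun seq_sub s -> 'I_K.+1 * 'I_K.+1}) (i : I) : R[i] :=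
  if insub i is Some u then
    (((phi u).1%:R * h - M) +i* ((phi u).2%:R * h - M))%C
  else 0.
have net0 phi i : i \notin s -> net phi i = 0.
  by move=> si; rewrite /net insubN.
exists #|{ffun seq_sub s -> 'I_K.+1 * 'I_K.+1}|, (fun j => net (enum_val j)).
split; first by move=> j; apply: (l2_finsupp us); exact: net0.
move=> f fl2 f1.
pose grid (x : R) : 'I_K.+1 := inord (Num.truncn ((x + M) / h)).
pose phi := [ffun u : seq_sub s =>
  (grid (complex.Re (T f (val u))), grid (complex.Im (T f (val u))))].
exists (enum_rank phi); rewrite enum_rankK.
have fi1 i : Normc.normc (f i) <= 1.
  rewrite -(@ler_pXn2r _ 2)// ?nnegrE// ?expr1n; last first.
    by case: (f i) => *; exact: sqrtr_ge0.
  by rewrite -lee_fin (le_trans (normc_le_l2sum f i))// l2sum_le1.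
have normc_ge0 (z : R[i]) : 0 <= Normc.normc z.
  by case: z => *; exact: sqrtr_ge0.
have Tfi i : Normc.normc (T f i) <= M.
  rewrite normc_diag (le_trans _ (lamM i))// ler_piMr//.
  exact: ltW.
have normcE (z : R[i]) : Normc.normc z ^+ 2 = complex.Re z ^+ 2 + complex.Im z ^+ 2.
  by case: z => x y /=; rewrite sqr_sqrtr// addr_ge0 ?sqr_ge0.
have ReM (z : R[i]) : `|complex.Re z| <= Normc.normc z.
  by rewrite -ler_sqr ?nnegrE// normcE real_normK ?num_real// lerDl sqr_ge0.
have ImM (z : R[i]) : `|complex.Im z| <= Normc.normc z.
  by rewrite -ler_sqr ?nnegrE// normcE real_normK ?num_real// lerDr sqr_ge0.
have near_net i : i \in s -> Normc.normc (T f i - net phi i) ^+ 2 <= h ^+ 2 *+ 2.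
  move=> si; rewrite /net insubT /= ffunE /=.
  have [k1 a1] := grid_approximation h0 (le_trans (ReM _) (Tfi i)).
  have [k2 a2] := grid_approximation h0 (le_trans (ImM _) (Tfi i)).
  rewrite normcE; move: a1 a2; rewrite /grid !inordK//; try exact: ltnW.
  case: (T f i) => x y /= a1 a2.
  rewrite mulr2n lerD// -[leLHS]real_normK ?num_real//.
    by rewrite ler_sqr ?nnegrE// ltW.
  by rewrite ler_sqr ?nnegrE// ltW.
have : (l2sum (fun i => (T f i - net phi i)%R) <= (e ^+ 2 / 2)%:E)%E.
  apply: (le_trans (@esum_le_finsupp_add _ _ _
    (fun i => t ^+ 2 * Normc.normc (f i) ^+ 2) s (h ^+ 2 *+ 2) _ _ _ _ near_net _)).
  - exact: us.
  - by move=> i; rewrite mulr_ge0 ?sqr_ge0.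
  - by move=> i; rewrite sqr_ge0.
  - by rewrite mulrn_wge0 ?sqr_ge0.
  - move=> i si; rewrite net0// subr0 normc_diag exprMn ler_wpM2r ?sqr_ge0//.
    rewrite lerXn2r ?nnegrE ?(ltW t0) ?(ltW (lam_gt0 _))//.
    by rewrite ltW// ltNge -sE.
  under eq_esum do rewrite EFinM.
  rewrite esumZl ?sqr_ge0//; last by move=> i; rewrite lee_fin sqr_ge0.
  apply: (@le_trans _ _ ((h ^+ 2 *+ 2 *+ size s)%:E + (t ^+ 2)%:E * 1)%E).
    rewrite leeD2l// lee_wpmul2l ?lee_fin ?sqr_ge0//.
    exact: l2sum_le1.
  rewrite mule1 -EFinD lee_fin /t /h.
  have N0 : 4 * (size s).+1%:R != 0 :> R by rewrite mulf_neq0 ?pnatr_eq0.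
  have -> : e = h * (4 * (size s).+1%:R) by rewrite divfK.
  rewrite mulfK// -[_ *+ size s]mulr_natr -[h ^+ 2 *+ 2]mulr_natr.
  rewrite -[(size s).+1%:R]natr1.
  have := sqr_ge0 h; have : 0 <= (size s)%:R :> R by [].
  move: (size s)%:R => n n0 hh.
  have : 0 <= h ^+ 2 * (4 * (n + 1) ^+ 2 - 2 * n).
    by rewrite mulr_ge0//; nra.
  move=> H; rewrite -subr_ge0 (le_trans H)// le_eqVlt.
  by apply/orP; left; apply/eqP; field.
move=> H; rewrite /l2norm -[ltRHS](gtr0_norm e0) -sqrtr_sqr ltr_sqrt ?exprn_gt0//.
rewrite (@le_lt_trans _ _ (e ^+ 2 / 2))//.
  rewrite -lee_fin fineK// ge0_fin_numE ?l2sum_ge0//.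
  by rewrite (le_lt_trans H)// ltry.
by rewrite ltr_pdivrMr// ltr_pMr ?exprn_gt0// ltr1n.
Qed.

Lemma positive_diag : positive_operator T.
Proof.
move=> f fl2; rewrite /inner.
have E i : (f i)^* * T f i = (lam i * Normc.normc (f i) ^+ 2)%:C%C.
  rewrite /diag_operator; case: (f i) => x y; apply/eqP; rewrite eq_complex /=.
  rewrite sqr_sqrtr ?addr_ge0 ?sqr_ge0//; apply/andP; split; apply/eqP; ring.
rewrite /csum; under eq_fun do rewrite E.
rewrite lecE /=; apply/andP; split.
  apply/eqP; rewrite /rsum /= !esum1 ?subrr// => i _.
    by rewrite E /= oppr0 maxxx.
  by rewrite E /= maxxx.
rewrite /rsum [X in _ - fine X]esum1 ?subr0.
  by rewrite fine_ge0// esum_ge0// => i _; rewrite lee_fin le_max lexx orbT.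
move=> i _; rewrite max_r// oppr_le0 mulr_ge0 ?sqr_ge0//.
exact: ltW.
Qed.

(** Testing the eigenvalue equation against the basis vector at [i] gives
    [(lam i ^+ 2 - s ^+ 2) * f i = 0], and [lam i + s] is positive. *)
Lemma abs_eigenspace_diag s : 0 < s ->
  abs_eigenspace T s =
  [set f : I -> R[i] | forall i,
    i \notin (fset_set [set i | lam i = s] : seq I) -> f i = 0].
Proof.
move=> s0.
have finE : finite_set [set i | lam i = s].
  by apply: sub_finite_set (lam_finite s0) => i /= ->.
set u : seq I := fset_set _.
have uu : uniq u by exact: fset_uniq.
have uE i : (i \in u) = (lam i == s).
  by rewrite in_fset_set//; apply/idP/eqP; rewrite inE.
apply/seteqP; split => [f [fl2 fE] i|f fu].
  rewrite uE => lamNs.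
  have := fE _ (l2_dirac_fun R i).
  have d0 j : j != i -> dirac_fun R i j = 0 by rewrite /dirac_fun => /negPf ->.
  rewrite !(@inner_singleton _ _ i)//; last first.
    by move=> j /d0; rewrite /diag_operator => ->; rewrite mulr0.
  rewrite /diag_operator /dirac_fun eqxx.
  have lams : lam i ^+ 2 - s ^+ 2 != 0.
    rewrite subr_eq0 -subr_eq0 subr_sqr mulf_neq0//; first by rewrite subr_eq0.
    by rewrite gt_eqF// addr_gt0.
  case: (f i) => x y /eqP; rewrite eq_complex /= => /andP[/eqP Hx /eqP Hy].
  apply/eqP; rewrite eq_complex /=; apply/andP; split.
    by rewrite -(mulrI_eq0 _ (mulfI lams)); apply/eqP; ring: Hx.
  by rewrite -(mulrI_eq0 _ (mulfI lams)); apply/eqP; ring: Hy.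
have fl2 : l2 f by exact: l2_finsupp fu.
split=> // g gl2; rewrite /inner !(csum_finsupp uu).
- rewrite mulr_sumr big_seq [RHS]big_seq; apply: eq_bigr => i; rewrite uE => /eqP <-.
  rewrite /diag_operator; case: (g i) => x y; case: (f i) => x' y'.
  by apply/eqP; rewrite eq_complex /=; apply/andP; split; apply/eqP; ring.
- by move=> i /fu ->; rewrite mulr0.
- by move=> i /fu; rewrite /diag_operator => ->; rewrite !mulr0.
Qed.

(** The bijection [e] matches the occurrences of [s] in [lam \o e] with a basis of the eigenspace.
    So [lam \o e] is a valid list, the definite description does not take its default value, and
    uniqueness identifies the two. *)
Lemma singular_values_diag (e : nat -> I) : injective e ->
  (forall i, exists n, e n = i) ->
  (forall m n, (m <= n)%N -> lam (e n) <= lam (e m)) ->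
  singular_values T = lam \o e.
Proof.
move=> e_inj e_surj e_homo.
have mult s : 0 < s -> exists m, has_dim (abs_eigenspace T s) m /\
    ([set n | lam (e n) = s] #= `I_m)%card.
  move=> s0.
  have finE : finite_set [set i | lam i = s].
    by apply: sub_finite_set (lam_finite s0) => i /= ->.
  have [m mE] := (finite_setP _).1 finE; exists m; split.
    rewrite abs_eigenspace_diag// -(card_fset_set mE).
    by apply: has_dim_finsupp; exact: fset_uniq.
  apply: card_eq_trans mE.
  rewrite card_eq_sym.
  have -> : [set i | lam i = s] = e @` [set n | lam (e n) = s].
    apply/seteqP; split => [i /= lis|_ [n ns <-]//].
    by have [n ni] := e_surj i; exists n; rewrite //= ni.
  by apply: inj_card_eq => m' n' _ _ /e_inj.
have esv : is_singular_values T (lam \o e).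
  split=> [n|m n /e_homo//|s s0] /=; first exact: ltW.
  by have [m [? ?]] := mult s s0; exists m.
have [sv0 sv_homo sv_mult] : is_singular_values T (singular_values T).
  by apply: xgetPex; exists (lam \o e).
apply: nonincreasing_multiplicity_inj => [||||s s0] //.
  by move=> n; exact/ltW/lam_gt0.
have [m Em cm] := sv_mult s s0; have [m' [Em' cm']] := mult s s0.
by exists m; split => //; rewrite (has_dim_unique Em Em').
Qed.

End DiagOperator.

(** * Absolute powers of the Dirac operator *)

Section AbsPow.
Variables (R : realType).
Local Open Scope complex_scope.

(** The block is normal with square [a ^+ 2], so each of its eigenvalues has modulus [a]. The
    function is therefore constant on the spectrum and yields a scalar matrix, whatever
    diagonalization is used. *)
Lemma mxcalc_swap (a b : R) : 0 < a ->
  mxcalc (fun z : R[i] => (Normc.normc z `^ b)%:C)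
    (a%:C *: \matrix_(i < 2, j < 2) (i != j)%:R) = ((a `^ b)%:C)%:M.
Proof.
move=> a_gt0; set A := _ *: _.
have AA : A *m A = ((a ^+ 2)%:C)%:M.
  rewrite /A -scalemxAl -scalemxAr scalerA; apply/matrixP => i j.
  rewrite !mxE big_ord_recl big_ord1 !mxE -rmorphM -expr2.
  by case: i j => [[|[|//]] ?] [[|[|//]] ?];
    rewrite -?val_eqE /= ?(mulr0, mul0r, mulr1, addr0, add0r).
have A_normal : A \is normalmx.
  have At : map_mx (@Num.conj _) A^T = A.
    apply/matrixP => i j; rewrite !mxE eq_sym.
    by case: (i != j); rewrite ?mulr1 ?mulr0; [exact: conjc_real|exact: rmorph0].
  by apply/normalmxP; rewrite At.
have /orthomx_spectralP AE := A_normal.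
rewrite /mxcalc; set P := spectralmx A in AE *; set d := spectral_diag A in AE *.
have Pu : P \in unitmx by exact: spectral_unit.
have DE : diag_mx d = P *m A *m invmx P.
  by rewrite [X in _ *m X *m _]AE !mulmxA mulmxV// mul1mx mulmxK.
have DD : diag_mx d *m diag_mx d = ((a ^+ 2)%:C)%:M.
  rewrite DE !mulmxA mulmxKV// -(mulmxA P) AA scalar_mxC -mulmxA mulmxV//.
  by rewrite mulmx1.
have normd i : Normc.normc (d 0 i) = a.
  have := congr1 (fun B : 'M[R[i]]_2 => B i i) DD.
  rewrite mulmx_diag !mxE eqxx !mulr1n => /(congr1 (@Normc.normc R)).
  rewrite Normc.normcM normcR ger0_norm ?sqr_ge0// -expr2 => /eqP.
  rewrite eqrXn2// ?(ltW a_gt0)// => [/eqP//|].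
  by case: (d 0 i) => *; exact: sqrtr_ge0.
have -> : map_mx (fun z => (Normc.normc z `^ b)%:C) d = const_mx (a `^ b)%:C.
  by apply/matrixP => i j; rewrite !mxE (ord1 i) normd.
by rewrite diag_const_mx scalar_mxC -mulmxA mulVmx// mulmx1.
Qed.

Lemma dirac_abs_pow_diag (k : nat) (V : finType) (L : kgraph k V)
    (delta b : R) : (forall g : finpath L, 0 < diam delta g) ->
  @dirac_abs_pow R k V L delta b =
  diag_operator (fun c : finpath L * 'I_2 => (diam delta c.1)^-1 `^ b).
Proof.
move=> diam_gt0; apply/funext => f; apply/funext => -[g i].
rewrite /dirac_abs_pow /block_operator /dirac_block mxcalc_swap ?invr_gt0//.
rewrite (bigD1 i)//= big1 => [|j ji]; first by rewrite mxE eqxx mulr1n addr0.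
by rewrite mxE eq_sym (negPf ji) mulr0n mul0r.
Qed.

End AbsPow.

(** * Dixmier traces *)

Section DixmierTrace.
Variables (R : realType) (I : choiceType).
Variables (T : (I -> R[i]) -> (I -> R[i])) (c : R).
Hypothesis sv_ge0 : forall n, 0 <= singular_values T n.
Hypothesis sv_cvg : (fun n => (ln n.+2%:R)^-1 *
  \sum_(0 <= j < n.+1) singular_values T j) @ \oo --> c.

(** Bridges two normalizations: the ideal divides by [ln n] and starts at index 1, the trace divides
    by [ln n.+2] and starts at 0. For [2 <= n] one has [n.+2 <= n ^ 2], so the change costs at most
    a factor 2. *)
Lemma limn_esup_singular_values :
  (limn_esup (fun n => ((ln n%:R)^-1 *
     \sum_(1 <= j < n.+1) singular_values T j)%:E) < +oo)%E.
Proof.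
rewrite /limn_esup /limf_esup.
apply: (@le_lt_trans _ _ (2 * (c + 1))%:E); last by rewrite ltry.
pose A := [set n | (2 <= n)%N /\
  (ln n.+2%:R)^-1 * \sum_(0 <= j < n.+1) singular_values T j <= c + 1].
apply: (@le_trans _ _ (ereal_sup [set ((ln n%:R)^-1 *
     \sum_(1 <= j < n.+1) singular_values T j)%:E | n in A])).
  apply: ereal_inf_lbound; exists A => //; near=> n; split.
    by near: n; exact: nbhs_infty_ge.
  near: n; apply: cvgr_le sv_cvg _ _; by rewrite ltrDl.
apply: ge_ereal_sup => _ [n [n2 An] <-]; rewrite lee_fin.
have n_gt0 : (0 < n)%N by exact: leq_trans n2.
have ln_gt0 : 0 < ln n%:R :> R by rewrite ln_gt0// ltr1n.
have ln2_gt0 : 0 < ln n.+2%:R :> R by rewrite exp.ln_gt0// ltr1n.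
rewrite (le_trans _ (ler_wpM2l _ An))// mulrA ler_pM ?invr_ge0 ?(ltW ln_gt0)//.
- by apply: sumr_ge0.
- rewrite ler_pdivlMr// mulrC ler_pdivrMr// mulr_natl -lnXn ?ltr0n//.
  rewrite ler_ln ?posrE ?exprn_gt0 ?ltr0n// -natrX ler_nat.
  case: n n2 {An n_gt0 ln_gt0 ln2_gt0} => [|[|n]]// _.
  rewrite expnS expn1 (@leq_trans (2 * n.+2)) ?leq_mul2r//.
  by rewrite mul2n !doubleS !ltnS -addnn leq_addr.
- by rewrite [leRHS]big_nat_recl// big_add1 lerDr.
Unshelve. all: by end_near. Qed.

Lemma generalized_limit_cvg omega (u : nat -> R) :
  generalized_limit omega -> u @ \oo --> c -> omega u = c.
Proof.
move=> [lin _ omega1 omega0 _] uc.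
have d0 : (fun n => u n - c) @ \oo --> (0 : R).
  by rewrite -(subrr c); apply: cvgB => //; exact: cvg_cst.
have -> : u = (fun n => c * 1 + (u n - c)).
  by apply/funext => n; rewrite mulr1 addrC subrK.
rewrite (lin c (fun=> 1) (fun n => u n - c)).
- by rewrite omega1 omega0// mulr1 addr0.
- by apply: cvg_seq_bounded; exact: is_cvg_cst.
- by apply: cvg_seq_bounded; apply/cvg_ex; exists 0.
Qed.

Lemma has_dixmier_trace_cvg : compact_operator T -> positive_operator T ->
  has_dixmier_trace T c.
Proof.
move=> compT posT; split => //; first by split => //; exact: limn_esup_singular_values.
by move=> omega lim_omega; exact: generalized_limit_cvg.
Qed.

End DixmierTrace.

Section DiagDixmierTrace.
Variables (R : realType) (I : choiceType) (lam : I -> R) (G : nat -> seq I).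
Variables (rho c0 c1 c2 c3 K : R).
Hypothesis lam_gt0 : forall i, 0 < lam i.
Hypothesis rho_gt1 : 1 < rho.
Hypothesis c0_ge0 : 0 <= c0.
Hypothesis c1_gt0 : 0 < c1.
Hypothesis c2_gt0 : 0 < c2.
Hypothesis c3_ge0 : 0 <= c3.
Hypothesis uniqG : forall q, uniq (G q).
Hypothesis sizeG_ge : forall q, (0 < q)%N -> c1 * rho ^+ q <= (size (G q))%:R.
Hypothesis sizeG_le : forall q, (size (G q))%:R <= c2 * rho ^+ q.
Hypothesis lam_outside : forall q i, i \notin G q -> lam i <= c3 / rho ^+ q.
Hypothesis sumG : forall q, `|\sum_(i <- G q) lam i - c0 * q%:R| <= K.

Lemma exp_unbounded (x : R) : exists q, x < rho ^+ q.
Proof.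
have rho_gt0 : 0 < rho by rewrite (lt_trans _ rho_gt1).
have [x_le0|x_gt0] := leP x 0; first by exists 0%N; rewrite (le_lt_trans x_le0).
have lnrho : 0 < ln rho by rewrite ln_gt0.
exists (Num.bound (`|ln x| / ln rho)).
rewrite -ltr_ln ?posrE ?exprn_gt0// lnXn// -mulr_natl -ltr_pdivrMr//.
apply: le_lt_trans (archi_boundP _); last by rewrite divr_ge0// ltW.
by rewrite ler_pM2r ?invr_gt0// ler_norm.
Qed.

(** The finite sets [G q] stand in for the largest eigenvalues: whatever is left out is
    O([rho ^- q]), and only O([rho ^+ q]) indices are involved, so sorting changes the partial sums
    by O(1). *)
Lemma has_dixmier_trace_diag :
  has_dixmier_trace (diag_operator lam) (c0 / ln rho).
Proof.
have rho_gt0 : 0 < rho by rewrite (lt_trans _ rho_gt1).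
have lam_finite s : 0 < s -> finite_set [set i | s <= lam i].
  move=> s0; have [q qP] := exp_unbounded (c3 / s).
  apply: (@sub_finite_set _ _ [set` G q]); last exact: finite_seq.
  move=> i /= si; apply: contraLR si => /lam_outside lamq.
  rewrite -ltNge (le_lt_trans lamq)// ltr_pdivrMr ?exprn_gt0//.
  by rewrite mulrC -ltr_pdivrMr.
have I_infinite : infinite_set [set: I].
  (* The successor [q.+1] is used below because the lower bound on sizes requires a positive
     index. *)
  move=> /finite_seqP[s sE]; have [q qP] := exp_unbounded ((size s)%:R / c1).
  have : (size (G q.+1) <= size s)%N.
    by apply: uniq_leq_size => // i _; have : [set: I] i by []; rewrite sE.
  rewrite -(ler_nat R) leNgt => /negP; apply.
  rewrite (lt_le_trans _ (sizeG_ge _))// mulrC -ltr_pdivrMr//.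
  by rewrite (lt_le_trans qP)// ler_eXn2l// ltW.
have [e [e_inj e_surj e_homo]] := decreasing_enumeration lam_gt0 lam_finite I_infinite.
have svE := singular_values_diag lam_gt0 lam_finite e_inj e_surj e_homo.
have sv0 n : 0 <= singular_values (diag_operator lam) n.
  by rewrite svE; exact/ltW/lam_gt0.
apply: has_dixmier_trace_cvg => //; last 2 first.
- exact: compact_diag.
- exact: positive_diag.
rewrite svE /=.
(* [K] is the error of the sums over [G q]; [c3 * c2] bounds the tail value times the size of
   [G q]. *)
apply: (@cvg_log_average R (fun n => \sum_(0 <= j < n) lam (e j))
  (fun q => size (G q)) rho c1 c2 c0 (K + c3 * c2)) => //.
- move=> m n mn; rewrite /= (big_cat_nat (leq0n m) mn)/= lerDl sumr_ge0// => j _.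
  exact: ltW.
- by rewrite big_geq.
- move=> q; have := sumG q; rewrite !ler_norml => /andP[lo hi].
  have lb := sum_le_rearrangement e_inj e_homo e_surj (uniqG q).
  have t0 : 0 <= c3 / rho ^+ q by rewrite divr_ge0// exprn_ge0// ltW.
  have ub := rearrangement_le_sum lam_gt0 e_inj (size (G q)) (uniqG q) t0
    (@lam_outside q).
  have : (c3 / rho ^+ q) *+ size (G q) <= c3 * c2.
    rewrite -mulr_natr -mulrA ler_wpM2l// mulrC ler_pdivrMr ?exprn_gt0//.
  have : 0 <= c3 * c2 by rewrite mulr_ge0// ltW.
  move=> *; apply/andP; split; lra.
Qed.

End DiagDixmierTrace.

(** * Paths in the Bratteli diagram *)

Section Paths.
Variables (k : nat) (V : finType) (L : kgraph k V).

Definition path_src (g : V * seq (bedge V)) : V := last g.1 (map (@esrc V) g.2).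

Definition level_edges (n : nat) (p : V) : seq (bedge V) :=
  [seq (p, q, j) | q <- enum V, j <- iota 0 (adj L (n %% k) p q)].

(** Paths are extended at the source end, so that one more level is one more matrix factor on the
    right in [adjprod]. *)
Fixpoint raw_paths (n : nat) : seq (V * seq (bedge V)) :=
  if n is n'.+1 then
    [seq (g.1, rcons g.2 e) | g <- raw_paths n', e <- level_edges n' (path_src g)]
  else [seq (v, [::]) | v <- enum V].

Definition paths (n : nat) : seq (finpath L) := pmap insub (raw_paths n).

Lemma mem_level_edges n p e :
  (e \in level_edges n p) = (erng e == p) && in_level L n.+1 e.
Proof.
case: e => -[p' q'] j'; rewrite /in_level /erng /esrc /=.
apply/allpairsPdep/andP => [[q [j [_ jq [-> -> ->]]]]|[/eqP -> jlt]].
  by rewrite mem_iota in jq.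
by exists q', j'; rewrite mem_enum mem_iota.
Qed.

Lemma uniq_level_edges n p : uniq (level_edges n p).
Proof.
apply: allpairs_uniq_dep.
- exact: enum_uniq.
- by move=> q _; exact: iota_uniq.
- by move=> [q j] [q' j'] _ _ /= [-> ->].
Qed.

Lemma chain_rcons n p s e : chain L n p (rcons s e) =
  [&& chain L n p s, erng e == last p (map (@esrc V) s)
    & in_level L (n + size s).+1 e].
Proof.
elim: s n p => [|e' s IH] n p /=; first by rewrite addn0 andbT.
by rewrite IH addSnnS !andbA.
Qed.

Lemma mem_raw_paths n g : (g \in raw_paths n) = chain L 0 g.1 g.2 && (size g.2 == n).
Proof.
elim: n g => [|n IH] [v s] /=.
  apply/mapP/andP => [[w _ [-> ->]]//|[_ /nilP ->]].
  by exists v; rewrite ?mem_enum.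
apply/allpairsPdep/andP => [[g [e [gn en [-> ->]]]]|].
  move: gn en; rewrite IH mem_level_edges => /andP[gc /eqP gn] /andP[eg en].
  by rewrite chain_rcons gc size_rcons gn eqxx /= add0n en (eqP eg) eqxx.
case/lastP: s => [[]//|s e]; rewrite chain_rcons size_rcons eqSS.
case=> /and3P[sc es se] /eqP sn; exists (v, s), e; split => //.
  by rewrite IH sc sn eqxx.
by rewrite mem_level_edges es; move: se; rewrite add0n sn.
Qed.

Lemma uniq_raw_paths n : uniq (raw_paths n).
Proof.
elim: n => [|n IH] /=; first by rewrite map_inj_uniq ?enum_uniq// => v w [].
apply: allpairs_uniq_dep => //.
- by move=> g _; exact: uniq_level_edges.
- by move=> [[v s] e] [[v' s'] e'] _ _ /= [-> /rcons_inj[-> ->]].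
Qed.

Lemma val_paths n : map val (paths n) = raw_paths n.
Proof.
rewrite /paths pmap_filter; last exact: insubK.
apply/all_filterP/allP => g; rewrite mem_raw_paths => /andP[gc _].
by rewrite insubT.
Qed.

Lemma mem_paths n g : (g \in paths n) = (flen g == n).
Proof.
rewrite -(mem_map val_inj) val_paths mem_raw_paths.
by case: g => g gc; rewrite /flen /fedges /= gc.
Qed.

Lemma uniq_paths n : uniq (paths n).
Proof. by rewrite -(map_inj_uniq val_inj) val_paths uniq_raw_paths. Qed.

Section Sums.
Variable R : realType.

Definition adjmat (i : nat) : 'M[R]_#|V| :=
  \matrix_(p, q) (adj L i (enum_val p) (enum_val q))%:R.

(** Its entries count the paths of length [n] with given range and source. *)
Fixpoint adjprod (n : nat) : 'M[R]_#|V| :=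
  if n is n'.+1 then adjprod n' *m adjmat (n' %% k) else 1%:M.

Definition colvec (h : V -> R) : 'cV[R]_#|V| := \col_p h (enum_val p).

Lemma sum_enum_val (h : V -> R) : \sum_(p < #|V|) h (enum_val p) = \sum_v h v.
Proof.
rewrite [RHS](reindex_onto enum_val enum_rank) /= => [|v _]; last first.
  exact: enum_rankK.
by apply: eq_bigl => p; rewrite enum_valK eqxx.
Qed.

Lemma adjmat_colvec i (h : V -> R) :
  adjmat i *m colvec h = colvec (fun v => \sum_w (adj L i v w)%:R * h w).
Proof.
apply/matrixP => p j; rewrite !mxE -sum_enum_val.
by apply: eq_bigr => q _; rewrite !mxE.
Qed.

(** Summing over the last edge replaces [h] by its image under the adjacency matrix of the last
    level; hence the induction runs over all [h]. *)
Lemma sum_paths n (h : V -> R) :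
  \sum_(g <- paths n) h (fsrc g) = \sum_p (adjprod n *m colvec h) p 0.
Proof.
have -> : \sum_(g <- paths n) h (fsrc g) = \sum_(g <- raw_paths n) h (path_src g).
  by rewrite -val_paths big_map.
elim: n h => [|n IH] h.
  rewrite /= big_map big_enum /= mul1mx -sum_enum_val.
  by apply: eq_bigr => p _; rewrite mxE.
rewrite /= -mulmxA adjmat_colvec -IH.
rewrite big_allpairs_dep; apply: eq_bigr => g _.
rewrite big_allpairs_dep big_enum /=; apply: eq_bigr => q _.
under eq_bigr do rewrite /path_src map_rcons last_rcons /=.
by rewrite /esrc /= big_const_seq count_predT size_iota iter_addr_0 mulr_natl.
Qed.

End Sums.
End Paths.

Lemma sum_nat_blocks (R : nmodType) (f : nat -> R) (k q : nat) :
  \sum_(0 <= m < q * k) f m = \sum_(0 <= p < q) \sum_(0 <= t < k) f (p * k + t)%N.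
Proof.
elim: q => [|q IH]; first by rewrite mul0n !big_geq.
rewrite mulSn addnC (big_cat_nat (leq0n (q * k)) (leq_addr _ _)) /= IH big_nat_recr//=.
congr (_ + _); rewrite -{1}[(q * k)%N]add0n big_addn addKn.
by apply: eq_bigr => t _; rewrite addnC.
Qed.

Lemma natr_size (R : pzSemiRingType) (T : Type) (s : seq T) :
  (size s)%:R = \sum_(c <- s) (1 : R).
Proof. by rewrite big_const_seq count_predT iter_addr_0. Qed.

(** The positive fixed vector acts as a barrier: [|y| <= C X] entrywise for some [C], and a
    nonnegative [P] fixing [X] preserves this bound. *)
Lemma mulmx_power_bounded (R : realFieldType) n (P : 'M[R]_n) (X : 'cV[R]_n) :
  (forall i j, 0 <= P i j) -> (forall i, 0 < X i 0) -> P *m X = X ->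
  forall y : 'cV_n, exists C, forall q i, `|(P ^+ q *m y) i 0| <= C.
Proof.
move=> P0 X0 PX y.
pose C := \sum_i `|y i 0| / X i 0.
have C0 : 0 <= C by apply: sumr_ge0 => i _; rewrite divr_ge0// ltW.
have bnd q i : `|(P ^+ q *m y) i 0| <= C * X i 0.
  elim: q i => [|q IH] i.
    rewrite expr0 mul1mx -ler_pdivrMr// /C (bigD1 i)//= lerDl sumr_ge0// => j _.
    by rewrite divr_ge0// ltW.
  rewrite exprS -mulmxE -mulmxA mxE (le_trans (ler_norm_sum _ _ _))//.
  rewrite -[in leRHS]PX [in leRHS]mxE mulr_sumr; apply: ler_sum => j _.
  by rewrite normrM (ger0_norm (P0 _ _)) mulrCA ler_wpM2l.
exists (C * \sum_i X i 0) => q i; rewrite (le_trans (bnd q i))// ler_wpM2l//.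
by rewrite (bigD1 i)//= lerDl sumr_ge0// => j _; exact: ltW.
Qed.

Lemma scalemx_exp (R : comPzRingType) n (a : R) (B : 'M[R]_n) q :
  (a *: B) ^+ q = a ^+ q *: B ^+ q.
Proof.
elim: q => [|q IH]; first by rewrite !expr0 scale1r.
by rewrite !exprS IH -!mulmxE -scalemxAl -scalemxAr scalerA.
Qed.

(** * Eigenvalue sums and path counts over periods of [k] levels *)

Section PathSpectrum.
Variables (R : realType) (k : nat) (V : finType) (L : kgraph k V).
Variables (x : V -> R) (delta : R) (r : nat -> R).
Hypothesis k_gt0 : (0 < k)%N.
Hypothesis delta_gt0 : 0 < delta.
Hypothesis delta_le1 : delta <= 1.
Hypothesis x_gt0 : forall v, 0 < x v.
Hypothesis sum_x : \sum_v x v = 1.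
Hypothesis r_gt0 : forall i, (i < k)%N -> 0 < r i.
Hypothesis adj_x : forall i v, (i < k)%N ->
  \sum_w (adj L i v w)%:R * x w = r i * x v.

(** The eigenvalue of [adjprod n] at the common eigenvector [x]; as [x] has sum 1, it is also the
    number of paths of length [n] weighted by [x] at the source. *)
Fixpoint growth (n : nat) : R :=
  if n is n'.+1 then growth n' * r (n' %% k) else 1.

Hypothesis growth_gt1 : 1 < growth k.

Definition path_eigenvalue (c : finpath L * 'I_2) : R :=
  x (fsrc c.1) `^ delta / growth (flen c.1).

Lemma growth_gt0 n : 0 < growth n.
Proof. by elim: n => //= n IH; rewrite mulr_gt0// r_gt0// ltn_mod. Qed.

Lemma growth_add q t : growth (q * k + t) = growth k ^+ q * growth t.
Proof.
(* For a fixed number of periods the case [t = 0] yields every [t]; taking [t = k] then yields the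
   case [t = 0] of the next period. *)
have step n : growth (n * k) = growth k ^+ n ->
    forall t, growth (n * k + t) = growth k ^+ n * growth t.
  move=> nE; elim=> [|t' IH]; first by rewrite addn0 nE mulr1.
  by rewrite addnS /= IH modnMDl mulrA.
apply: (step); elim: q => [|q IH]; first by rewrite mul0n expr0.
by rewrite mulSn addnC step// exprSr.
Qed.

Lemma adjprod_add q t : adjprod L R (q * k + t) = adjprod L R k ^+ q *m adjprod L R t.
Proof.
have step n : adjprod L R (n * k) = adjprod L R k ^+ n ->
    forall t, adjprod L R (n * k + t) = adjprod L R k ^+ n *m adjprod L R t.
  move=> nE; elim=> [|t' IH]; first by rewrite addn0 nE mulmx1.
  by rewrite addnS /= IH modnMDl mulmxA.
apply: (step); elim: q => [|q IH]; first by rewrite mul0n expr0.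
by rewrite mulSn addnC step// exprSr.
Qed.

Lemma adjprod_x n : adjprod L R n *m colvec x = growth n *: colvec x.
Proof.
elim: n => [|n IH] /=; first by rewrite mul1mx scale1r.
rewrite -mulmxA adjmat_colvec.
have -> : colvec (fun v => \sum_w (adj L (n %% k) v w)%:R * x w) =
    r (n %% k) *: colvec x.
  by apply/matrixP => p j; rewrite !mxE adj_x// ltn_mod.
by rewrite -scalemxAr IH scalerA mulrC.
Qed.

Lemma adjprod_ge0 n i j : 0 <= adjprod L R n i j.
Proof.
elim: n i j => [|n IH] i j /=; first by rewrite mxE; case: eqP.
by rewrite mxE sumr_ge0// => l _; rewrite mulr_ge0// mxE.
Qed.

Lemma sum_paths_x n : \sum_(g <- paths L n) x (fsrc g) = growth n.
Proof.
rewrite sum_paths adjprod_x -[RHS]mulr1 -sum_x -(sum_enum_val x) mulr_sumr.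
by apply: eq_bigr => p _; rewrite !mxE.
Qed.

Lemma x_le1 v : x v <= 1.
Proof.
by rewrite -sum_x (bigD1 v)//= lerDl sumr_ge0// => w _; exact: ltW.
Qed.

Definition level (n : nat) : seq (finpath L * 'I_2) :=
  [seq (g, b) | g <- paths L n, b <- enum 'I_2].

Fixpoint levels_below (n : nat) : seq (finpath L * 'I_2) :=
  if n is n'.+1 then levels_below n' ++ level n' else [::].

Lemma mem_level n c : (c \in level n) = (flen c.1 == n).
Proof.
case: c => g b; rewrite /= -mem_paths; apply/allpairsPdep/idP.
  by case=> g' [b' [g'n _ [-> _]]].
by move=> gn; exists g, b; rewrite gn mem_enum.
Qed.

Lemma mem_levels_below n c : (c \in levels_below n) = (flen c.1 < n)%N.
Proof. by elim: n => //= n IH; rewrite mem_cat IH mem_level ltnS orbC -leq_eqVlt. Qed.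

Lemma uniq_levels_below n : uniq (levels_below n).
Proof.
elim: n => //= n IH; rewrite cat_uniq IH /=; apply/andP; split.
  apply/hasPn => c; rewrite mem_level => /eqP <-.
  by rewrite /= mem_levels_below ltnn.
apply: allpairs_uniq; rewrite ?uniq_paths ?enum_uniq// => -[g b] [g' b'] _ _ /=.
by move=> [-> ->].
Qed.

Lemma sum_level n (f : finpath L -> R) :
  \sum_(c <- level n) f c.1 = 2 * \sum_(g <- paths L n) f g.
Proof.
rewrite /level big_allpairs_dep mulr_sumr.
apply: eq_bigr => g _ /=.
by rewrite big_enum /= big_ord_recl big_ord1 mulr2n mulrDl mul1r.
Qed.

Lemma sum_levels_below q (f : finpath L -> R) :
  \sum_(c <- levels_below (q * k)) f c.1 =
  \sum_(0 <= p < q) \sum_(0 <= t < k) 2 * \sum_(g <- paths L (p * k + t)) f g.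
Proof.
rewrite -(sum_nat_blocks (fun m => 2 * \sum_(g <- paths L m) f g)).
elim: (q * k)%N => [|n IH].
  by rewrite big_geq// big_nil.
by rewrite /= big_cat /= IH big_nat_recr//= sum_level.
Qed.

Lemma path_eigenvalue_gt0 c : 0 < path_eigenvalue c.
Proof. by rewrite divr_gt0 ?powR_gt0 ?growth_gt0. Qed.

(** Since [0 < x <= 1] and [delta <= 1], [x] is at most its [delta]-th power, and the sum of [x]
    over the level is exactly [growth n]. *)
Lemma sum_path_eigenvalue_ge n :
  1 <= \sum_(g <- paths L n) x (fsrc g) `^ delta / growth n.
Proof.
rewrite -mulr_suml ler_pdivlMr ?growth_gt0// mul1r -sum_paths_x.
apply: ler_sum => g _; apply: ger1_powR => //.
by rewrite x_gt0 x_le1.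
Qed.

Lemma levels_below_asymptotics : exists c0 K, forall q,
  `|\sum_(c <- levels_below (q * k)) path_eigenvalue c - c0 * q%:R| <= K.
Proof.
(* Transfer matrix of one full period, normalized so as to fix [x]. *)
pose P := (growth k)^-1 *: adjprod L R k.
have gk0 : growth k != 0 by rewrite gt_eqF// growth_gt0.
have Pbnd : forall y : 'cV_#|V|, exists C, forall q i, `|(P ^+ q *m y) i 0| <= C.
  apply: (@mulmx_power_bounded _ _ _ (colvec x)).
  - by move=> i j; rewrite mxE mulr_ge0 ?adjprod_ge0// invr_ge0 ltW// growth_gt0.
  - by move=> i; rewrite mxE.
  - by rewrite /P -scalemxAl adjprod_x scalerA mulVf// scale1r.
pose xd := colvec (fun v => x v `^ delta).
(* [y] gathers the [k] levels of one period; the factor 2 is the dimension of the block at each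
   path. *)
pose y := \sum_(0 <= t < k) (2 / growth t) *: (adjprod L R t *m xd).
have sumE q : \sum_(c <- levels_below (q * k)) path_eigenvalue c =
    \sum_i (\sum_(0 <= p < q) P ^+ p *m y) i 0.
  rewrite (sum_levels_below q (fun g => x (fsrc g) `^ delta / growth (flen g))).
  under [RHS]eq_bigr do rewrite summxE.
  rewrite [RHS]exchange_big /=; apply: eq_bigr => p _.
  under [RHS]eq_bigr do rewrite /y mulmx_sumr summxE.
  rewrite [RHS]exchange_big /=; apply: eq_bigr => t _.
  rewrite big_seq.
  under eq_bigr => g do [rewrite mem_paths => /eqP ->].
  rewrite -big_seq -mulr_suml (sum_paths L (p * k + t) (fun v => x v `^ delta)) -/xd.
  rewrite mulrC -mulrA mulr_suml; apply: eq_bigr => i _.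
  rewrite /P scalemx_exp -scalemxAr -scalemxAl scalerA mulmxA -adjprod_add.
  rewrite growth_add [RHS]mxE.
  by rewrite exprVn invfM; ring.
have [z [w [Pz yE]]] := mean_ergodic Pbnd y.
have [C HC] := Pbnd w.
(* The fixed part [z] gives the slope; each coordinate of [w - P ^+ q *m w] costs at most one [C]
   for either term. *)
exists (\sum_i z i 0), (#|V|%:R * (C + C)) => q.
rewrite sumE yE (sum_mean_ergodic _ _ Pz).
move: (P ^+ q *m w) (HC q) => u Cu.
rewrite mulr_suml -sumrB (le_trans (ler_norm_sum _ _ _))//.
rewrite -[X in _ <= X%:R * _]card_ord mulr_natl -sumr_const.
apply: ler_sum => i _; rewrite !mxE mulmxnE mulr_natr addrAC subrr add0r.
rewrite (le_trans (ler_normB _ _))// lerD//.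
  by have := HC 0%N i; rewrite expr0 mul1mx.
Qed.

(** Keeping only the first level of each period already gives 2 per period; this is what will make
    the slope [c0], and so the trace, positive. *)
Lemma sum_levels_below_ge q :
  2 * q%:R <= \sum_(c <- levels_below (q * k)) path_eigenvalue c.
Proof.
rewrite (sum_levels_below q (fun g => x (fsrc g) `^ delta / growth (flen g))).
rewrite mulr_natr -[q in leLHS]subn0 -sumr_const_nat; apply: ler_sum => p _.
rewrite (big_ltn k_gt0) -[leLHS]addr0 lerD//.
  rewrite ler_peMr// big_seq.
  under eq_bigr => g do [rewrite mem_paths => /eqP ->].
  by rewrite -big_seq sum_path_eigenvalue_ge.
apply: sumr_ge0 => t _; rewrite mulr_ge0// sumr_ge0// => g _.
by rewrite divr_ge0 ?powR_ge0// ltW// growth_gt0.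
Qed.

Lemma size_levels_below q : (size (levels_below (q * k)))%:R =
  \sum_(0 <= p < q) \sum_(0 <= t < k) 2 * (size (paths L (p * k + t)))%:R :> R.
Proof.
rewrite natr_size (sum_levels_below q (fun=> 1)).
by apply: eq_bigr => p _; apply: eq_bigr => t _; rewrite natr_size.
Qed.

(** Only the first level of the last period is kept, which costs one factor [growth k]; as [x <= 1],
    it has at least [growth ((q - 1) * k)] paths. *)
Lemma size_levels_below_ge q : (0 < q)%N ->
  (growth k)^-1 * growth k ^+ q <= (size (levels_below (q * k)))%:R.
Proof.
case: q => // q _; rewrite exprS mulKf ?gt_eqF ?growth_gt0//.
rewrite size_levels_below big_nat_recr//= -[leLHS]add0r lerD//.
  by apply: sumr_ge0 => p _; apply: sumr_ge0 => t _; rewrite mulr_ge0.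
rewrite (big_ltn k_gt0) addn0 -[leLHS]addr0 lerD//.
  have -> : growth k ^+ q = growth (q * k).
    by rewrite -[(q * k)%N]addn0 growth_add mulr1.
  rewrite -sum_paths_x (@le_trans _ _ (size (paths L (q * k)))%:R)//.
    by rewrite natr_size; apply: ler_sum => g _; exact: x_le1.
  by rewrite ler_peMl// ler1n.
by apply: sumr_ge0 => t _; rewrite mulr_ge0.
Qed.

Lemma sum_growth_geometric q :
  \sum_(0 <= p < q) growth k ^+ p <= growth k ^+ q / (growth k - 1).
Proof.
have g1 : 0 < growth k - 1 by rewrite subr_gt0.
rewrite ler_pdivlMr// mulrC.
rewrite big_mkord -subrX1 lerBlDr lerDl ler01//.
Qed.

(** [B * x v] is at least 1 at every vertex, so level [n] has at most [B * growth n] paths; over the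
    periods these bounds form a geometric series. *)
Lemma size_levels_below_le : exists2 c2, 0 < c2 & forall q,
  (size (levels_below (q * k)))%:R <= c2 * growth k ^+ q.
Proof.
pose B := \sum_v (x v)^-1; pose A := \sum_(0 <= t < k) growth t.
have B_gt0 : 0 <= B by apply: sumr_ge0 => v _; rewrite invr_ge0 ltW.
have A_ge0 : 0 <= A by apply: sumr_ge0 => t _; rewrite ltW// growth_gt0.
have g1 : 0 < growth k - 1 by rewrite subr_gt0.
have size_le n : (size (paths L n))%:R <= B * growth n.
  rewrite -sum_paths_x mulr_sumr natr_size; apply: ler_sum => g _.
  rewrite -ler_pdivrMr// mul1r /B (bigD1 (fsrc g))//= lerDl.
  by apply: sumr_ge0 => v _; rewrite invr_ge0 ltW.
(* The summand 1 makes the constant positive. *)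
exists (2 * (B * A) / (growth k - 1) + 1).
  by rewrite ltr_wpDl// divr_ge0 ?(ltW g1)// !mulr_ge0.
move=> q; rewrite size_levels_below.
apply: (@le_trans _ _ (2 * (B * A) * \sum_(0 <= p < q) growth k ^+ p)).
  rewrite mulr_sumr; apply: ler_sum => p _.
  rewrite -mulr_sumr -!mulrA ler_wpM2l//.
  rewrite [A * _]mulrC /A !mulr_sumr; apply: ler_sum => t _.
  by rewrite (le_trans (size_le _))// growth_add.
rewrite [leRHS]mulrDl mul1r -[leLHS]addr0 lerD ?exprn_ge0 ?(ltW (growth_gt0 _))//.
rewrite -[leRHS]mulrA ler_wpM2l ?mulr_ge0// mulrC.
exact: sum_growth_geometric.
Qed.

(** The path has at least [q] full periods, and [growth k] exceeds 1. Inside a period [growth] need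
    not be monotone, so the remainder is bounded by the sum of all inverse growths. *)
Lemma path_eigenvalue_outside q c : c \notin levels_below (q * k) ->
  path_eigenvalue c <= (\sum_(0 <= t < k) (growth t)^-1) / growth k ^+ q.
Proof.
rewrite mem_levels_below -leqNgt /path_eigenvalue => qc.
set n := flen c.1 in qc *.
have gX p : 0 < growth k ^+ p by rewrite exprn_gt0// growth_gt0.
rewrite (divn_eq n k) growth_add invfM mulrA [leRHS]mulrC.
have qn : (q <= n %/ k)%N by rewrite leq_divRL.
rewrite ler_pM ?invr_ge0 ?(ltW (growth_gt0 _))//.
- by rewrite mulr_ge0 ?powR_ge0// invr_ge0 ltW.
- rewrite (@le_trans _ _ (growth k ^+ (n %/ k))^-1)//.
    rewrite ler_piMl ?invr_ge0 ?(ltW (gX _))//.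
    have -> : 1 = 1 `^ delta :> R by rewrite powR1.
    by rewrite ge0_ler_powR ?nnegrE ?x_le1 ?(ltW delta_gt0) ?(ltW (x_gt0 _)).
  by rewrite lef_pV2 ?posrE// ler_eXn2l.
- have nk : (n %% k < k)%N by rewrite ltn_mod.
  rewrite big_mkord (bigD1 (Ordinal nk))//= lerDl sumr_ge0// => t _.
  by rewrite invr_ge0 ltW// growth_gt0.
Qed.

Lemma has_dixmier_trace_paths :
  exists2 c, 0 < c & has_dixmier_trace (diag_operator path_eigenvalue) c.
Proof.
have [c0 [K HK]] := levels_below_asymptotics.
have [c2 c2_gt0 size_le] := size_levels_below_le.
have c0_gt0 : 0 < c0.
  rewrite ltNge; apply/negP => c0_le0.
  have K_ge0 : 0 <= K by rewrite (le_trans _ (HK 0%N)).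
  (* With [c0 <= 0] the sum over [q] periods would stay below [K], although it is at least
     [2 * q]. *)
  have := archi_boundP K_ge0; set q := Num.bound K; apply/negP; rewrite -leNgt.
  have := HK q; rewrite ler_norml => /andP[_].
  have := sum_levels_below_ge q.
  have : c0 * q%:R <= 0 by rewrite mulr_le0_ge0.
  have : 0 <= q%:R :> R by [].
  lra.
exists (c0 / ln (growth k)); first by rewrite divr_gt0// ln_gt0.
apply: (@has_dixmier_trace_diag _ _ _ (fun q => levels_below (q * k))
  (growth k) c0 (growth k)^-1 c2 (\sum_(0 <= t < k) (growth t)^-1) K) => //.
- exact: path_eigenvalue_gt0.
- exact: ltW.
- by rewrite invr_gt0 growth_gt0.
- by apply: sumr_ge0 => t _; rewrite invr_ge0 ltW// growth_gt0.
- by move=> q; exact: uniq_levels_below.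
- exact: size_levels_below_ge.
- exact: path_eigenvalue_outside.
Qed.

End PathSpectrum.

(** * Consequences of the weight and diameter hypotheses *)

Section WeightGrowth.
Variables (R : realType) (k : nat) (V : finType) (L : kgraph k V) (delta : R).
Hypothesis k_gt0 : (0 < k)%N.
Hypothesis V_gt0 : (0 < #|V|)%N.
Hypothesis delta_gt0 : 0 < delta.
Hypothesis w_weight : is_weight (@w_delta R k V L delta).
Hypothesis w_diam : forall g : finpath L, w_delta delta g = diam delta g.

Local Notation x := (pf_vector R L).
Local Notation r := (rho R L).

(** If there were no such vector, the default value 0 would make [w_delta] vanish, contradicting the
    positivity of a weight. *)
Lemma pf_vectorP : is_pf_vector L x.
Proof.
have [w_gt0 _ _ _] := w_weight; have [v _] := card_gt0P V_gt0.
apply: contrapT => Nx.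
have := w_gt0 (fvertex L v); rewrite /w_delta.
have -> : pf_vector R L = fun=> 0.
  apply: xgetPN => y yP; apply: Nx.
  by apply: xgetPex; exists y.
by rewrite mulr0 ltxx.
Qed.

(** Without infinite paths every diameter would be the supremum of the empty set, which is 0,
    whereas diameters equal positive weights. *)
Lemma exists_infpath : exists y, infpath L y.
Proof.
have [w_gt0 _ _ _] := w_weight; have [v _] := card_gt0P V_gt0.
apply: contrapT => /forallNP Ny.
have := w_gt0 (fvertex L v); rewrite w_diam /diam.
rewrite (_ : [set _ | _] = set0) ?sup0 ?ltxx//.
by apply/seteqP; split => // a [y [y' [[/Ny]]]].
Qed.

(** An infinite path crosses an edge counted by the [i]-th adjacency matrix, so applying this matrix
    to the positive eigenvector gives a positive entry. *)
Lemma rho_gt0 i : (i < k)%N -> 0 < r i.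
Proof.
move=> ik; have [x_gt0 _ adj_x] := pf_vectorP.
have [y /(_ i)[yi _]] := exists_infpath.
rewrite /in_level /= (modn_small ik) in yi.
rewrite -(pmulr_lgt0 _ (x_gt0 (erng (y i)))) -(adj_x (Ordinal ik)) /=.
rewrite (bigD1 (esrc (y i)))//= ltr_wpDr//.
  by apply: sumr_ge0 => v _; rewrite mulr_ge0// ltW.
by rewrite mulr_gt0// ltr0n (leq_ltn_trans _ yi).
Qed.

Lemma growth_prod t : (t <= k)%N -> growth k r t = \prod_(i < k | (i < t)%N) r i.
Proof.
move=> tk; rewrite -(big_ord_widen _ r tk).
elim: t tk => [|t IH] tk; first by rewrite big_ord0.
by rewrite big_ord_recr /= (modn_small tk) (IH (ltnW tk)).
Qed.

Lemma w_deltaE (g : finpath L) :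
  w_delta delta g = growth k r (flen g) `^ (- delta^-1) * x (fsrc g).
Proof.
rewrite /w_delta; congr (_ `^ _ * _); set q := (_ %/ k)%N; set t := (_ %% k)%N.
have tk : (t < k)%N by rewrite ltn_mod.
rewrite (divn_eq (flen g) k) growth_add -/q -/t (growth_prod (ltnW tk)).
have -> : growth k r k = \prod_(i < k) r i.
  by rewrite (growth_prod (leqnn k)); apply: eq_bigl => i; rewrite ltn_ord.
rewrite -prodrXl [in RHS](bigID (fun i : 'I_k => (i < t)%N)) /=.
under eq_bigr do rewrite exprSr.
rewrite big_split /= mulrAC; congr (_ * _ * _).
by apply: eq_bigl => i; rewrite -leqNgt.
Qed.

(** Otherwise the weights at lengths [n * k] would stay above a positive lower bound [e] of the
    eigenvector, and their suprema could not tend to 0. *)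
Lemma growth_gt1 : 1 < growth k r k.
Proof.
have [x_gt0 sum_x adj_x] := pf_vectorP.
have r_gt0 := rho_gt0.
have g_gt0 n : 0 < growth k r n by exact: growth_gt0.
have [_ _ w_cvg _] := w_weight.
rewrite ltNge; apply/negP => g_le1.
pose e := (\sum_v (x v)^-1)^-1.
have [v0 _] := card_gt0P V_gt0.
have le_sum v : (x v)^-1 <= \sum_v (x v)^-1.
  by rewrite (bigD1 v)//= lerDl sumr_ge0// => w _; rewrite invr_ge0 ltW.
have sum_gt0 : 0 < \sum_v (x v)^-1.
  by rewrite (lt_le_trans _ (le_sum v0))// invr_gt0.
have e_gt0 : 0 < e by rewrite invr_gt0.
have e_le v : e <= x v by rewrite -[leRHS]invrK lef_pV2 ?posrE ?invr_gt0.
have [n _ nP] := cvgr0_norm_lt _ w_cvg _ e_gt0.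
have := nP (n * k)%N; rewrite /= leq_pmulr// => /(_ isT).
apply/negP; rewrite -leNgt (le_trans _ (ler_norm _))//.
(* A level whose [x]-weighted path count is positive contains a path. *)
have [g gn] : exists g : finpath L, flen g = (n * k)%N.
  have := g_gt0 (n * k)%N.
  rewrite -(sum_paths_x k_gt0 sum_x (fun i v ik => adj_x (Ordinal ik) v)).
  case E : (paths L (n * k)) => [|g s]; first by rewrite big_nil ltxx.
  by move=> _; exists g; apply/eqP; rewrite -mem_paths E inE eqxx.
have g1 : growth k r (n * k) <= 1.
  rewrite -[(n * k)%N]addn0 growth_add mulr1 exprn_ile1//.
  exact: ltW.
apply: (@le_trans _ _ (w_delta delta g)).
  rewrite (le_trans (e_le (fsrc g)))// w_deltaE gn ler_peMl ?(ltW (x_gt0 _))//.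
  rewrite powRN -[leLHS]invr1 lef_pV2 ?posrE ?powR_gt0//.
  have -> : 1 = 1 `^ (delta^-1) :> R by rewrite powR1.
  by rewrite ge0_ler_powR ?nnegrE ?invr_ge0 ?(ltW delta_gt0) ?(ltW (g_gt0 _)).
(* The supremum dominates the weight of [g] only once the weights of this level are known to be
   bounded. *)
apply: ub_le_sup; last by exists g.
exists (growth k r (n * k) `^ (- delta^-1)) => _ [h hn <-].
rewrite w_deltaE hn ler_piMr ?powR_ge0//.
by rewrite -sum_x (bigD1 (fsrc h))//= lerDl sumr_ge0// => v _; exact: ltW.
Qed.

Lemma diam_powR (g : finpath L) :
  (diam delta g)^-1 `^ (- delta) = x (fsrc g) `^ delta / growth k r (flen g).
Proof.
have [x_gt0 _ _] := pf_vectorP.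
have g_gt0 : 0 < growth k r (flen g) by apply: growth_gt0 => //; exact: rho_gt0.
have d_gt0 : 0 < diam delta g by rewrite -w_diam; have [w_gt0 _ _ _] := w_weight.
rewrite -powR_inv1 ?(ltW d_gt0)// -powRrM mulrNN mul1r -w_diam w_deltaE.
rewrite powRM ?powR_ge0 ?(ltW (x_gt0 _))// -powRrM mulNr mulVf ?gt_eqF//.
by rewrite powR_inv1 ?(ltW g_gt0)// mulrC.
Qed.

End WeightGrowth.

Theorem corollary3p19 (R : realType) (k : nat) (V : finType) (L : kgraph k V)
    (delta : R) (k_gt0 : (0 < k)%N) (V_gt0 : (0 < #|V|)%N)
    (L_finite : kgraph_finite L) (L_connected : strongly_connected L)
    (delta_gt0 : 0 < delta) (delta_lt1 : delta < 1)
    (w_weight : is_weight (@w_delta R k V L delta))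
    (w_diam : forall g : finpath L, w_delta delta g = diam delta g) :
  connes_measurable (@dirac_abs_pow R k V L delta (- delta)) /\
  exists2 c : R, has_dixmier_trace (@dirac_abs_pow R k V L delta (- delta)) c
    & 0 < c.
Proof.
have [w_gt0 _ _ _] := w_weight.
have [x_gt0 sum_x adj_x] := pf_vectorP V_gt0 w_weight.
have r_gt0 := rho_gt0 V_gt0 w_weight w_diam.
have adj_x' i v : (i < k)%N -> \sum_w (adj L i v w)%:R * pf_vector R L w =
    rho R L i * pf_vector R L v by move=> ik; exact: (adj_x (Ordinal ik)).
have [c c_gt0 Tc] : exists2 c, 0 < c
    & has_dixmier_trace (@dirac_abs_pow R k V L delta (- delta)) c.
  (* The diameters are positive because they equal the weights. *)
  rewrite dirac_abs_pow_diag => [|g]; last by rewrite -w_diam.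
  have := has_dixmier_trace_paths k_gt0 delta_gt0 (ltW delta_lt1) x_gt0 sum_x
    r_gt0 adj_x' (growth_gt1 k_gt0 V_gt0 delta_gt0 w_weight w_diam).
  have -> // : path_eigenvalue (pf_vector R L) delta (rho R L) =
      (fun c : finpath L * 'I_2 => (diam delta c.1)^-1 `^ (- delta)).
  by apply/funext => b; rewrite (diam_powR k_gt0 V_gt0 delta_gt0 w_weight w_diam).
by split; exists c.
Qed.
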